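(* Let $k\in\mathbb N$ be fixed. Let $(v_j)_{j\in\mathbb N}$ be the enumeration of the vertices of $T$ in increasing breadth-first order. For all $n>|T_{k-1}|$ define $A_n=\Delta(v_n)\setminus T_{k-1}$. Let $Q$ be a transition kernel on a metric space $\mathcal X$ which is uniformly geometrically ergodic and has a unique invariant probability measure $\pi$. Let $X=(X_u)_{u\in T}$ be a branching Markov chain with transition kernel $Q$ and initial distribution $\pi$. Let $\mathrm f=(f_{\mathcal S}:\mathcal X^{\mathcal S}\to\mathbb R)_{\mathcal S\in\mathcal N_k}$ be a collection of neighborhood-shape-dependent Borel functions that are in $L^2(X)$. Then $$\bar M_{A_n}(\mathrm f)\xrightarrow[n\to\infty]{}\mathbb E_{U_k}\otimes\mathbb E_Q\big[f_{\mathcal S_{U_k}}(X_{\Delta(U_k)})\big]\qquad\text{in }L^2,$$ where $U_k$ is uniformly distributed over the $k$-th generation of $T$ and independent of $X$, and $\mathbb E_{U_k}\otimes\mathbb E_Q$ is the joint expectation over $U_k$ and $X$.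
   Context: $T=\bigcup_{n\ge0}\{0,1\}^n$ is the infinite complete plane rooted binary tree with root $\partial$; $u$ has left child $u0$ and right child $u1$; $p(u)$ is the parent, $p^k(u)$ the $k$-th ancestor, $\mathrm{ht}(u)$ the height. $T_n=\{u:\mathrm{ht}(u)\le n\}$, $T_{-1}=\emptyset$; the $n$-th generation is $\mathbb G_n=\{u:\mathrm{ht}(u)=n\}$; $T(u)$ is the set of descendants of $u$ (including $u$). Breadth-first order: $u\le v$ iff $\mathrm{ht}(u)<\mathrm{ht}(v)$, or $\mathrm{ht}(u)=\mathrm{ht}(v)$ and $u$ precedes or equals $v$ lexicographically. $v_0=\partial$. For $0\le k\le\mathrm{ht}(u)$: $\Delta^*(u,k)=\{v\in T(p^k(u)):v<u\}$, $\Delta(u,k)=\Delta^*(u,k)\cup\{u\}$, $\Delta(u)=\Delta(u,\mathrm{ht}(u))=\{v\in T: v\le u\}$. Shapes: for $\mathrm{ht}(u)\ge k$ there is a unique $w\in\mathbb G_k$ such that $\Delta(u,k)$ and $\Delta(w)$ are isomorphic as finite rooted plane trees (equal up to translation); the shape of $\Delta(u,k)$ is $\mathcal S_u:=\Delta(w)$. The finite set of possible shapes is $\mathcal N_k=\{\Delta(w):w\in\mathbb G_k\}$. A collection of neighborhood-shape-dependent functions is a family $(f_{\mathcal S}:\mathcal X^{\mathcal S}\to\mathbb R)_{\mathcal S\in\mathcal N_k}$; $f_{\mathcal S_u}(X_{\Delta(u,k)})$ is the evaluation of $f_{\mathcal S_u}$ at $X_{\Delta(u,k)}=(X_v)_{v\in\Delta(u,k)}$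 after identifying $\Delta(u,k)$ with its shape. It is in $L^2(X)$ if $f_{\mathcal S}(X_{\mathcal S})$ is square integrable for all $\mathcal S\in\mathcal N_k$. For a finite $A\subset T\setminus T_{k-1}$, $\bar M_A(\mathrm f)=|A|^{-1}\sum_{u\in A}f_{\mathcal S_u}(X_{\Delta(u,k)})$. Branching Markov chain with kernel $Q$ and initial distribution $\nu$: for all $n$, $(X_u)_{u\in T_n}$ has law $\nu(dx_\partial)\prod_{u\in T_n\setminus\{\partial\}}Q(x_{p(u)};dx_u)$. $\mathbb E_Q$ is expectation for $X$. $Q$ is uniformly geometrically ergodic if there are $\rho\in(0,1)$ and $C<\infty$ with $\|Q^n(x;\cdot)-\pi\|_{TV}\le C\rho^n$ for all $x\in\mathcal X$, $n\in\mathbb N$. *)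

(* Defs.v *)
From HB Require Import structures.
From mathcomp Require Import all_boot all_order all_algebra finmap.
From mathcomp Require Import all_classical all_reals all_analysis.

Set Implicit Arguments.
Unset Strict Implicit.
Unset Printing Implicit Defensive.

Import Order.TTheory GRing.Theory Num.Theory.
Import numFieldNormedType.Exports.

Local Open Scope classical_set_scope.
Local Open Scope ring_scope.
Local Open Scope fset_scope.

(* A vertex is the word read along the path from the root [::]; the left and
   right children of u are rcons u false and rcons u true, and ht u = size u. *)
Notation tree := (seq bool).

Definition parent (u : tree) : tree := take (size u).-1 u.

Definition anc (k : nat) (u : tree) : tree := iter k parent u.

Fixpoint words (n : nat) : seq tree :=
  if n is m.+1 then [seq b :: w | b <- [:: false; true], w <- words m]
  else [:: [::]].

(* Vertices of height between m and m + n - 1, in breadth-first order. *)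
Definition levels (m n : nat) : seq tree :=
  flatten [seq words i | i <- iota m n].

Definition Gen (n : nat) : {fset tree} := [fset u in words n].

(* Tlt n is the set of vertices of height < n, so that T_n = Tlt n.+1 and
   T_(n-1) = Tlt n, including T_(-1) = Tlt 0 = fset0. *)
Definition Tlt (n : nat) : {fset tree} := [fset u in levels 0 n].

Definition bfs_le (u v : tree) : bool :=
  (size u < size v)%N ||
  ((size u == size v) && ((u : seqlexi bool) <= (v : seqlexi bool))%O).

Definition bfs_lt (u v : tree) : bool := (u != v) && bfs_le u v.

Definition bfs_enumeration (v : nat -> tree) : Prop :=
  (forall i j, (i < j)%N -> bfs_lt (v i) (v j)) /\
  (forall u, exists n, v n = u).

(* Descendants of p^k(u) strictly before u; restricting to heights <= ht u only
   serves to get a finite set and loses nothing, see in_Delta_star. *)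
Definition Delta_star (u : tree) (k : nat) : {fset tree} :=
  [fset v in Tlt (size u).+1 | prefix (anc k u) v && bfs_lt v u].

Definition Delta (u : tree) (k : nat) : {fset tree} := u |` Delta_star u k.

Definition Delta_full (u : tree) : {fset tree} := Delta u (size u).

(* The set of shapes N_k. *)
Definition shapes (k : nat) : {fset {fset tree}} :=
  [fset Delta_full w | w in Gen k].

(* Writing u = p^k(u) w with w of length k, the shape of Delta u k is
   Delta_full w; shapeP and shape_uniq below show that w is the unique element
   of G_k for which Delta u k is a translate of Delta_full w. *)
Definition shape (k : nat) (u : tree) : {fset tree} :=
  Delta_full (drop (size u - k) u).

Lemma in_words (n : nat) (u : tree) : (u \in words n) = (size u == n).
Proof.
elim: n u => [|n IH] [|b u] //=.
- by apply/negbTE; rewrite !mem_cat in_nil orbF negb_or;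
    apply/andP; split; apply/negP => /mapP[].
- rewrite cats0 eqSS -IH mem_cat; apply/orP/idP.
    by case=> /mapP[w hw [_ ->]].
  by move=> hu; case: b; [right|left]; apply/mapP; exists u.
Qed.

Lemma in_Gen (n : nat) (u : tree) : (u \in Gen n) = (size u == n).
Proof. by rewrite !inE /= in_words. Qed.

Lemma in_levels (m n : nat) (u : tree) :
  (u \in levels m n) = (m <= size u < m + n)%N.
Proof.
rewrite -mem_iota; apply/flattenP/idP.
  by case=> s /mapP[i hi ->]; rewrite in_words => /eqP ->.
by move=> hu; exists (words (size u)); [exact: map_f|rewrite in_words].
Qed.

Lemma in_Tlt (n : nat) (u : tree) : (u \in Tlt n) = (size u < n)%N.
Proof. by rewrite !inE /= in_levels. Qed.

Lemma bfs_lt_size (u v : tree) : bfs_lt u v -> (size u <= size v)%N.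
Proof. by case/andP=> _ /orP[/ltnW//|/andP[/eqP-> _]]. Qed.

Lemma in_Delta_star (u : tree) (k : nat) (v : tree) :
  (v \in Delta_star u k) = prefix (anc k u) v && bfs_lt v u.
Proof.
rewrite in_fset inE /= in_Tlt ltnS.
case lt_vu: (bfs_lt v u); first by rewrite (bfs_lt_size lt_vu).
by rewrite !andbF.
Qed.

Lemma ancE (k : nat) (u : tree) : anc k u = take (size u - k) u.
Proof.
elim: k => [|k IH]; first by rewrite subn0 take_size.
rewrite /anc iterS -/(anc k u) IH /parent.
rewrite size_takel ?leq_subr// -subnS -take_min; congr take.
exact/minn_idPl/leq_sub2l.
Qed.

Lemma ltxi_cat (a u v : tree) :
  ((a ++ u : seqlexi bool) <= (a ++ v : seqlexi bool))%O
  = ((u : seqlexi bool) <= (v : seqlexi bool))%O.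
Proof. by elim: a => //= b a IH; rewrite lexi_cons lexx /= IH. Qed.

Lemma bfs_lt_cat (a u v : tree) : bfs_lt (a ++ u) (a ++ v) = bfs_lt u v.
Proof.
by rewrite /bfs_lt /bfs_le ltxi_cat !size_cat ltn_add2l eqn_add2l eqseq_cat ?eqxx.
Qed.

Lemma in_Delta (u : tree) (k : nat) (v : tree) :
  (v \in Delta u k) = (v == u) || (prefix (anc k u) v && bfs_lt v u).
Proof. by rewrite in_fset1U in_Delta_star. Qed.

Lemma in_Delta_full (u v : tree) :
  (v \in Delta_full u) = (v == u) || bfs_lt v u.
Proof. by rewrite in_Delta ancE subnn take0 prefix0s. Qed.

Lemma bfs_lt_asym (u v : tree) : bfs_lt u v -> ~~ bfs_lt v u.
Proof.
rewrite /bfs_lt /bfs_le => /andP[/eqP uv].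
case: ltngtP => //= [_ _|_ le_uv]; first by rewrite andbF.
by apply/negP => /andP[_ le_vu]; apply: uv; apply: (@le_anti _ (seqlexi bool)); rewrite le_uv.
Qed.

Lemma Delta_full_inj : injective Delta_full.
Proof.
move=> u v /fsetP uv.
have := uv u; have := uv v; rewrite !in_Delta_full !eqxx /=.
have [//|/= _] := eqVneq v u.
by move=> /bfs_lt_asym/negbTE ->.
Qed.

Lemma shapeP (k : nat) (u : tree) : (k <= size u)%N ->
  Delta u k = [fset anc k u ++ v | v in shape k u].
Proof.
move=> ku; apply/fsetP => v; rewrite in_Delta ancE /shape.
set a := take _ _; set w := drop _ _.
have -> : u = a ++ w by rewrite cat_take_drop.
apply/orP/imfsetP => /= [|[x xw ->]].
  case=> [/eqP->|/andP[/prefixP[x ->] lt_x]].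
    by exists w; rewrite // in_Delta_full eqxx.
  by exists x; rewrite // in_Delta_full -(bfs_lt_cat a) lt_x orbT.
rewrite prefix_prefix bfs_lt_cat eqseq_cat ?eqxx //=.
by apply/orP; rewrite -in_Delta_full.
Qed.

Lemma shape_in (k : nat) (u : tree) : (k <= size u)%N -> shape k u \in shapes k.
Proof.
move=> ku; apply/imfsetP; exists (drop (size u - k) u) => //=.
by rewrite inE in_words size_drop subKn.
Qed.

Lemma shape_uniq (k : nat) (u a w : tree) : (k <= size u)%N ->
  w \in Gen k -> Delta u k = [fset a ++ v | v in Delta_full w] ->
  w = drop (size u - k) u.
Proof.
move=> _; rewrite in_Gen => /eqP sw Duk.
have uE : u = a ++ w.
  have : u \in Delta u k by rewrite in_Delta eqxx.
  rewrite Duk => /imfsetP[x /=]; rewrite in_Delta_full.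
  move=> /orP[/eqP-> //|lt_xw ux].
  have : a ++ w \in Delta u k.
    by rewrite Duk; apply/imfsetP; exists w; rewrite //= in_Delta_full eqxx.
  rewrite in_Delta ux eqseq_cat // eqxx /= bfs_lt_cat (negbTE (bfs_lt_asym lt_xw)).
  by rewrite andbF orbF => /eqP ->.
by rewrite uE size_cat sw addnK drop_size_cat.
Qed.

(* measurableType is pointed in the library, whence a pointed (that is,
   nonempty) metric space. *)
#[short(type="pmetricType")]
HB.structure Definition PointedMetric (R : numDomainType) :=
  {T of Pointed T & Metric R T}.

Definition borel {R : numDomainType} (M : pmetricType R) :=
  g_sigma_algebraType (@open M).
HB.instance Definition _ {R : numDomainType} (M : pmetricType R) :=
  Measurable.on (@borel R M).

Definition cylinders (I : Type) {d : measure_display} (T : measurableType d) :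
    set (set (I -> T)) :=
  \bigcup_(i in [set: I]) preimage_set_system setT (fun x : I -> T => x i)
    measurable.

(* I -> T with the product sigma-algebra. *)
Definition powspace (I : Type) {d : measure_display} (T : measurableType d) :=
  g_sigma_algebraType (@cylinders I d T).
HB.instance Definition _ (I : Type) {d : measure_display}
    (T : measurableType d) := Measurable.on (@powspace I d T).

Section Kernels.
Context {R : realType} {d : measure_display} {T : measurableType d}.
Implicit Types (Q : R.-pker T ~> T) (pi : probability T R).
Local Open Scope ereal_scope.

Fixpoint kpow Q (n : nat) (x : T) (A : set T) : \bar R :=
  if n is m.+1 then \int[Q x]_y kpow Q m y A else \d_x A.

Definition invariant_proba Q pi : Prop :=
  forall A, measurable A -> \int[pi]_x Q x A = pi A.

Definition unique_invariant_proba Q pi : Prop :=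
  invariant_proba Q pi /\
  forall pi' : probability T R, invariant_proba Q pi' ->
    forall A, measurable A -> pi' A = pi A.

Definition tv_dist (mu nu : set T -> \bar R) : \bar R :=
  ereal_sup [set `|mu A - nu A| | A in measurable].

Definition unif_geom_ergodic Q pi : Prop :=
  exists rho C : R, [/\ (0 < rho)%R, (rho < 1)%R &
    forall (x : T) (n : nat),
      tv_dist (kpow Q n x) pi <= (C * rho ^+ n)%:E].

(* Integration of g against Q(x_p(u1); dx_u1) ... Q(x_p(um); dx_um), for
   s = [:: u1; ...; um] listing each vertex after its parent; the coordinates
   of x outside s are parameters. *)
Fixpoint kernel_int Q (s : seq tree) (g : (tree -> T) -> \bar R)
    (x : tree -> T) : \bar R :=
  if s is u :: s' then
    \int[Q (x (parent u))]_y kernel_int Q s' g [eta x with u |-> y]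
  else g x.

(* levels 1 n lists T_n minus the root; the value of the constant family
   fun=> x0 is overwritten at every vertex of T_n but the root. *)
Definition branching_markov_chain {d' : measure_display}
    {Omega : measurableType d'} (P : probability Omega R) (nu : probability T R)
    Q (X : tree -> {RV P >-> T}) : Prop :=
  forall (n : nat) (B : set (powspace (Tlt n.+1) T)), measurable B ->
    P [set w | B (fun v : Tlt n.+1 => X (val v) w)] =
    \int[nu]_x0 kernel_int Q (levels 1 n)
      (fun x => (\1_B (fun v : Tlt n.+1 => x (val v)))%:E) (fun=> x0).

End Kernels.

Section Averages.
Context {R : realType} {M : Type}.
(* Only the values f S with S in shapes k are ever used. *)
Implicit Types f : forall S : {fset tree}, (S -> M) -> R.

(* f_(S_u)(x_Delta(u,k)), with Delta u k identified with its shape by the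
   translation v |-> p^k(u) v. *)
Definition shape_eval (k : nat) f (u : tree) (x : tree -> M) : R :=
  f (shape k u) (fun v : shape k u => x (anc k u ++ val v)).

Definition Mbar (k : nat) (A : {fset tree}) f (x : tree -> M) : R :=
  (#|` A|%:R)^-1 * \sum_(u <- A) shape_eval k f u x.

End Averages.

Definition uniform_on_Gen {R : realType} {d : measure_display}
    {Omega : measurableType d} (P : probability Omega R) (k : nat)
    (U : Omega -> tree) : Prop :=
  (forall w, U w \in Gen k) /\
  forall u, u \in Gen k ->
    measurable (U @^-1` [set u]) /\
    P (U @^-1` [set u]) = ((#|` Gen k|%:R)^-1)%:E.

Definition cvg_L2 {R : realType} {d : measure_display}
    {Omega : measurableType d} (P : probability Omega R)
    (Y : nat -> Omega -> R) (Z : Omega -> R) : Prop :=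
  [/\ forall n, Y n \in Lfun P 2%:E, Z \in Lfun P 2%:E &
      ('N[P]_2%:E[EFin \o (Y n \- Z)%R])%E @[n --> \oo] --> 0%E].

(* Main.v *)
Require Import Defs.
From HB Require Import structures.
From mathcomp Require Import all_boot all_order all_algebra finmap.
From mathcomp Require Import all_classical all_reals all_analysis.
From mathcomp Require Import measurable_realfun ring lra zify.

Set Implicit Arguments.
Unset Strict Implicit.
Unset Printing Implicit Defensive.

Import Order.TTheory GRing.Theory Num.Theory.
Import numFieldNormedType.Exports.

Local Open Scope classical_set_scope.
Local Open Scope ring_scope.
Local Open Scope fset_scope.

(** A vertex [u] of height at least [k] is written [u = a ++ w], with [a] its
    [k]-th ancestor and [w] a word of length [k]. Its contribution to the
    average is a function [F w] of the process seen from [a], in the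
    coordinates of height at most [k]; below it is called the block of [u].

    The mean. Since [pi] is invariant, the process seen from any vertex has the
    law of the process seen from the root ([stationary_law]), so the mean of
    the block of [u] depends on [w] only. In breadth-first order the vertices
    come in runs [a ++ w] with [a] fixed and [w] running through all the words
    of length [k], so every word occurs in [A_n] with a frequency that tends to
    [2 ^ - k] ([word_frequency]); hence the means average to the expectation
    over a uniform word.

    The fluctuations. By stationarity, cutting the functions [F w] off at a
    high level costs little in mean square, uniformly in the vertex
    ([excess_small]); so they may be taken bounded. Given the generations up
    to [D], the blocks in subtrees of different vertices of generation [D] are
    independent, and the conditional mean of a block whose base lies [n]
    generations further is the [n]-th iterate of [Q] applied to a bounded
    function, hence exceeds its mean by at most a multiple of [C * rho ^+ n]
    ([decorrelation]). The pairs of vertices with a common ancestor in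
    generation [D] are a fraction of order [2 ^ - D] of all pairs, and the
    pairs with a vertex of bounded height a fraction that vanishes as [A_n]
    grows ([variance_bound]). Choosing in this order the cutoff, the number of
    generations that makes [C * rho ^+ n] small, [D], and the height of the
    last vertex gives [block_average_cvg].

    The law of the chain is given by the iterated integrals [kernel_int] of
    indicators. They are integrals against a probability kernel on the space
    of configurations ([kernel_int_repr]); so the description of the law
    extends to nonnegative measurable functions ([integral_law]), and the
    conditional statements above become identities between iterated
    integrals. *)

(** * Product spaces and kernels *)

Section ProductSpace.
Context {d : measure_display} {T : measurableType d}.

Lemma measurable_coord (I : Type) (i : I) :
  measurable_fun [set: powspace I T] (fun x : powspace I T => x i).
Proof.
move=> _ A mA; apply: sub_sigma_algebra; exists i => //; exists A => //.
Qed.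

Lemma measurable_powspace {d'} {T' : measurableType d'} (I : Type)
    (h : T' -> powspace I T) :
  (forall i, measurable_fun setT (fun t => h t i)) -> measurable_fun setT h.
Proof.
move=> mh.
apply: (@measurability _ _ _ (powspace I T) _ _ (@cylinders I d T)) => //.
move=> _ [B [i _ [A mA <-]] <-].
by have := mh i measurableT A mA; rewrite !setTI.
Qed.

Definition upd (x : tree -> T) (u : tree) (y : T) : tree -> T :=
  [eta x with u |-> y].

Lemma measurable_upd u :
  measurable_fun [set: powspace tree T * T]
    (fun z => upd z.1 u z.2 : powspace tree T).
Proof.
apply: measurable_powspace => v /=; rewrite /upd /=.
case: (v == u); first exact: measurable_snd.
exact: measurableT_comp (measurable_coord v) _.
Qed.

Definition translate (a : tree) (x : tree -> T) : tree -> T :=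
  fun v => x (a ++ v).

Lemma measurable_translate a :
  measurable_fun [set: powspace tree T]
    (translate a : powspace tree T -> powspace tree T).
Proof. by apply: measurable_powspace => v; exact: measurable_coord. Qed.

End ProductSpace.

Section Comap.
Context {d1 d2 d3 : measure_display} {X : measurableType d1}
  {Y : measurableType d2} {Z : measurableType d3} {R : realType}.

Section Def.
Variables (k : R.-pker Y ~> Z) (f : X -> Y).

(** The hypothesis is an argument so that the kernel structure can be attached
    to the definition. *)
Definition kcomap (mf : measurable_fun setT f) (x : X) :
  {measure set Z -> \bar R} := k (f x).

Hypothesis mf : measurable_fun setT f.

Let measurable_kcomap U : measurable U ->
  measurable_fun setT (kcomap mf ^~ U).
Proof.
move=> mU; apply: (measurableT_comp (f := k ^~ U)) => //.
exact: measurable_kernel.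
Qed.

HB.instance Definition _ := isKernel.Build _ _ _ _ _ (kcomap mf)
  measurable_kcomap.

Let kcomap_prob x : kcomap mf x [set: Z] = 1%E.
Proof. by rewrite /kcomap prob_kernel. Qed.

HB.instance Definition _ := Kernel_isProbability.Build _ _ _ _ _
  (kcomap mf) kcomap_prob.
End Def.

Local Open Scope ereal_scope.

(** Composition stays within probability kernels, which is what keeps every
    iterated integral below normalized. *)
Lemma pker_comp (l : R.-pker X ~> Y) (k : R.-pker (X * Y) ~> Z) :
  exists m : R.-pker X ~> Z, forall x g,
    (forall z, 0 <= g z) -> measurable_fun setT g ->
    \int[m x]_z g z = \int[l x]_y \int[k (x, y)]_z g z.
Proof.
have prob x : (l \; k) x setT = 1.
  rewrite /= /kcomp; under eq_integral do rewrite prob_kernel.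
  by rewrite integral_cst// prob_kernel mule1.
pose pb := Kernel_isProbability.Build _ _ _ _ _ (l \; k) prob.
pose m : R.-pker X ~> Z := HB.pack (l \; k) pb.
by exists m => x g g0 mg; rewrite /= integral_kcomp.
Qed.

End Comap.

(** * Iterated kernel integrals along the tree *)

Definition depends_on {T V : Type} (S : pred tree) (g : (tree -> T) -> V) :=
  forall x y, (forall u, S u -> x u = y u) -> g x = g y.

Local Notation below k := [pred u : tree | size u <= k]%N.

Lemma sub_depends_on {T V : Type} (S S' : pred tree) (g : (tree -> T) -> V) :
  (forall u, S u -> S' u) -> depends_on S g -> depends_on S' g.
Proof. by move=> SS' Sg x y xy; apply: Sg => u /SS'; exact: xy. Qed.

Lemma size_parent u : size (parent u) = (size u).-1.
Proof. by rewrite size_takel ?leq_pred. Qed.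

Lemma parent_cat a u : u != [::] -> parent (a ++ u) = a ++ parent u.
Proof.
case/lastP: u => // u b _; rewrite /parent -rcons_cat !size_rcons /=.
by rewrite -!cats1 !take_size_cat.
Qed.

Section KernelInt.
Context {R : realType} {d : measure_display} {T : measurableType d}.
Variable Q : R.-pker T ~> T.
Local Open Scope ereal_scope.
Local Notation W := (powspace tree T).
Implicit Types (s : seq tree) (g : (tree -> T) -> \bar R) (x : tree -> T).

(** This representation gives measurability in the parameters and the
    convergence theorems for [kernel_int] all at once, instead of an induction
    on [s] for each. *)
Lemma kernel_int_repr s : exists m : R.-pker W ~> W, forall x g,
    (forall z, 0 <= g z) -> measurable_fun [set: W] g ->
  kernel_int Q s g x = \int[m x]_z g z.
Proof.
elim: s => [|u s [m mE]].
  exists (kdirac (@measurable_id _ W setT)) => x g g0 mg.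
  by rewrite integral_dirac//= diracT mul1e.
have [m' m'E] := pker_comp (kcomap Q (measurable_coord (parent u)))
  (kcomap m (measurable_upd u)).
exists m' => x g g0 mg; rewrite m'E//=.
by apply: eq_integral => y _; rewrite mE.
Qed.

Lemma measurable_kernel_int s g : (forall z, 0 <= g z) ->
  measurable_fun [set: W] g -> measurable_fun [set: W] (kernel_int Q s g).
Proof.
move=> g0 mg; have [m mE] := kernel_int_repr s.
rewrite (_ : kernel_int Q s g = fun x => \int[m x]_z g z).
  apply: measurable_fun_integral_kernel => // U mU; exact: measurable_kernel.
by apply/funext => x; rewrite mE.
Qed.

Lemma kernel_int_ge0 s g x : (forall z, 0 <= g z) -> 0 <= kernel_int Q s g x.
Proof.
by move=> g0; elim: s x => [|u s IH] x //=; apply: integral_ge0 => y _.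
Qed.

Lemma kernel_int_cat s1 s2 g x :
  kernel_int Q (s1 ++ s2) g x = kernel_int Q s1 (kernel_int Q s2 g) x.
Proof.
by elim: s1 x => //= u s1 IH x; apply: eq_integral => y _; rewrite IH.
Qed.

Lemma eq_kernel_int s g1 g2 x : g1 =1 g2 ->
  kernel_int Q s g1 x = kernel_int Q s g2 x.
Proof. by move=> /funext ->. Qed.

Lemma integral_pker_cst (x : T) (c : \bar R) : \int[Q x]_y c = c.
Proof. by rewrite integral_cst// prob_kernel mule1. Qed.

(** Every integration is then of a constant against a probability measure. *)
Lemma kernel_int_independent s S g x : depends_on S g ->
    {in s, forall u, ~~ S u} ->
  kernel_int Q s g x = g x.
Proof.
move=> Sg; elim: s x => //= u s IH x us.
rewrite -[RHS](integral_pker_cst (x (parent u))); apply: eq_integral => y _.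
rewrite IH => [|v vs]; last by rewrite us// inE vs orbT.
apply: Sg => v Sv /=; case: eqP => // vu.
by move: (us v); rewrite vu mem_head -vu Sv => /(_ isT).
Qed.

(** Integrating out a vertex of [S] only brings in its parent, and a vertex
    outside [S] has no effect. *)
Lemma depends_on_kernel_int s (S : pred tree) g : depends_on S g ->
  {in s, forall u, S u -> S (parent u)} -> depends_on S (kernel_int Q s g).
Proof.
move=> Sg; elim: s => // u s IH sS /=.
have {}IH : depends_on S (kernel_int Q s g).
  by apply: IH => v vs; apply: sS; rewrite inE vs orbT.
have [Su|nSu] := boolP (S u) => x y xy.
  rewrite (xy (parent u)) ?sS ?mem_head//; apply: eq_integral => z _.
  by apply: IH => v Sv /=; case: eqP => // _; exact: xy.
have erase x' z : kernel_int Q s g [eta x' with u |-> z] = kernel_int Q s g x'.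
  by apply: IH => v Sv /=; case: eqP => // vu; rewrite -vu Sv in nSu.
under eq_integral do rewrite erase.
under [RHS]eq_integral do rewrite erase.
by rewrite !integral_pker_cst; exact: IH.
Qed.

(** Contrary to [depends_on_kernel_int], this one removes the integrated
    vertices from the dependence set. *)
Lemma depends_on_kernel_int_parents s (A : pred tree) g :
    depends_on [pred u | A u || (u \in s)] g ->
    {in s, forall u, A (parent u)} ->
  depends_on A (kernel_int Q s g).
Proof.
elim: s A => [|u s IH] A Ag sA x y xy /=.
  by apply: Ag => u /=; rewrite orbF; exact: xy.
rewrite (xy (parent u)) ?sA ?mem_head//; apply: eq_integral => z _.
apply: (IH (predU1 u A)).
- by apply: sub_depends_on Ag => v /=; rewrite !inE -!orbA orbCA.
- by move=> v vs; apply/orP; right; apply: sA; rewrite inE vs orbT.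
- by move=> v /orP[|Av] /=; [move=> ->|rewrite xy].
Qed.

Lemma levelsD m n p : levels m (n + p) = levels m n ++ levels (m + n) p.
Proof. by rewrite /levels iotaD map_cat flatten_cat. Qed.

(** The generations are removed one at a time, from the highest; the parents
    of a generation all lie in the previous one. *)
Lemma depends_on_kernel_int_levels n m g :
  depends_on (below (n + m)) g ->
  depends_on (below n) (kernel_int Q (levels n.+1 m) g).
Proof.
elim: m n => [|m IH] n ng; first by rewrite addn0 in ng.
rewrite (_ : kernel_int _ _ _ =
    kernel_int Q (words n.+1) (kernel_int Q (levels n.+2 m) g)); last first.
  by apply/funext => x; rewrite -kernel_int_cat.
apply: depends_on_kernel_int_parents => [|u]; last first.
  by rewrite in_words /= size_parent => /eqP ->.
apply: (@sub_depends_on _ _ (below n.+1)) => [u|].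
  change ((size u <= n.+1)%N -> (size u <= n)%N || (u \in words n.+1)).
  by rewrite in_words leq_eqVlt ltnS orbC.
by apply: IH; rewrite addSnnS.
Qed.

(** Conditional independence. Each vertex of [s] lies outside [S1] or outside
    [S2], so that at each integration one of the two factors is a constant. *)
Lemma kernel_int_prod s (S1 S2 : pred tree) g1 g2 x :
    (forall z, 0 <= g1 z) -> (forall z, 0 <= g2 z) ->
    measurable_fun [set: W] g1 -> measurable_fun [set: W] g2 ->
    depends_on S1 g1 -> depends_on S2 g2 ->
    {in s, forall u, S1 u -> S1 (parent u)} ->
    {in s, forall u, S2 u -> S2 (parent u)} ->
    {in s, forall u, ~~ (S1 u && S2 u)} ->
  kernel_int Q s (fun z => g1 z * g2 z) x =
  kernel_int Q s g1 x * kernel_int Q s g2 x.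
Proof.
move=> g10 g20 mg1 mg2 Sg1 Sg2.
elim: s x => //= u s IH x s1 s2 s12.
(* restriction to the tail of [s] of a property of all its vertices *)
have tail (P : tree -> Prop) :
    {in u :: s, forall v, P v} -> {in s, forall v, P v}.
  by move=> h v vs; apply: h; rewrite inE vs orbT.
under eq_integral do rewrite (IH _ (tail _ s1) (tail _ s2) (tail _ s12)).
have erase (S : pred tree) g z : depends_on S g -> ~~ S u ->
    {in s, forall v, S v -> S (parent v)} ->
    kernel_int Q s g [eta x with u |-> z] = kernel_int Q s g x.
  move=> Sg nSu sS; apply: (depends_on_kernel_int Sg sS) => v Sv /=.
  by case: eqP => // vu; rewrite -vu Sv in nSu.
have mslice g : (forall z, 0 <= g z) -> measurable_fun [set: W] g ->
    measurable_fun setT (fun y : T => kernel_int Q s g [eta x with u |-> y]).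
  move=> g0 mg; apply: (measurableT_comp (measurable_kernel_int s g0 mg)).
  apply: measurable_powspace => v /=; case: (v == u); first exact: measurable_id.
  exact: measurable_cst.
have := s12 u (mem_head _ _); rewrite negb_and => /orP[n1|n2].
- under eq_integral do rewrite (erase _ _ _ Sg1 n1 (tail _ s1)).
  under [X in X * _]eq_integral do rewrite (erase _ _ _ Sg1 n1 (tail _ s1)).
  rewrite integral_pker_cst ge0_integralZl//; first exact: mslice.
  + by move=> y _; exact: kernel_int_ge0.
  + exact: kernel_int_ge0.
- under eq_integral do rewrite (erase _ _ _ Sg2 n2 (tail _ s2)).
  under [X in _ * X]eq_integral do rewrite (erase _ _ _ Sg2 n2 (tail _ s2)).
  rewrite integral_pker_cst ge0_integralZr//; first exact: mslice.
  + by move=> y _; exact: kernel_int_ge0.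
  + exact: kernel_int_ge0.
Qed.

(** Vertices outside the subtree of [a] integrate to one, and those inside
    keep their order. As [a] itself is not in [s], the parents of the
    remaining vertices are translated as well. *)
Lemma kernel_int_translate s a g x :
    {in s, forall u, size a < size u}%N ->
  kernel_int Q s (g \o translate a) x =
  kernel_int Q [seq drop (size a) u | u <- s & prefix a u] g (translate a x).
Proof.
elim: s x => //= u s IH x sa.
have {}IH y := IH y (fun v vs => sa v (@mem_behead _ (u :: s) v vs)).
have au := sa u (mem_head _ _).
case: ifPn => [/prefixP[v uE]|nau] /=.
  rewrite uE drop_size_cat// parent_cat; last first.
    by case: v uE au => // ->; rewrite cats0 ltnn.
  apply: eq_integral => y _; rewrite IH; congr kernel_int.
  by apply/funext => w; rewrite /translate /= eqseq_cat// eqxx.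
rewrite -[RHS](integral_pker_cst (x (parent u))); apply: eq_integral => y _.
rewrite IH; congr kernel_int; apply/funext => w; rewrite /translate /=.
by case: eqP => // uE; rewrite -uE prefix_prefix in nau.
Qed.

Lemma words_below a n :
  [seq drop (size a) u | u <- words (size a + n) & prefix a u] = words n.
Proof.
elim: a => [|b a IH] /=.
  rewrite add0n (eq_filter (a2 := predT)) ?filter_predT => [|u]; last exact: prefix0s.
  by rewrite (eq_map (g := id)) ?map_id => // u; rewrite drop0.
have same c (w : seq tree) :
    [seq drop (size a).+1 u | u <- [seq c :: v | v <- w] & prefix (b :: a) u] =
    if b == c then [seq drop (size a) u | u <- w & prefix a u] else [::].
  rewrite filter_map -map_comp; case: eqP => [->|bc].
    by congr map; apply: eq_filter => u /=; rewrite eqxx.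
  by rewrite (eq_filter (a2 := pred0)) ?filter_pred0// => u /=; case: eqP.
rewrite cats0 filter_cat map_cat !same IH.
by case: b {same} => //=; rewrite cats0.
Qed.

Lemma levels_below a m n :
  [seq drop (size a) u | u <- levels (size a + m) n & prefix a u] = levels m n.
Proof.
elim: n m => // n IH m.
have levelsS p : levels p n.+1 = words p ++ levels p.+1 n by [].
by rewrite !levelsS filter_cat map_cat words_below -addnS IH.
Qed.

End KernelInt.

(** * Law and Markov property of the chain *)

Section EqIntegral.
Context {d1 d2 d3 : measure_display} {X1 : measurableType d1}
  {X2 : measurableType d2} {Y : measurableType d3} {R : realType}.
Local Open Scope ereal_scope.

Lemma eq_law_integral (m1 : {measure set X1 -> \bar R})
    (m2 : {measure set X2 -> \bar R}) (h1 : X1 -> Y) (h2 : X2 -> Y) g :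
    measurable_fun setT h1 -> measurable_fun setT h2 ->
    (forall B, measurable B -> m1 (h1 @^-1` B) = m2 (h2 @^-1` B)) ->
    (forall y, 0 <= g y) -> measurable_fun setT g ->
  \int[m1]_x g (h1 x) = \int[m2]_x g (h2 x).
Proof.
move=> mh1 mh2 m12 g0 mg.
have g0' : {in [set: Y], forall y, 0 <= g y} by [].
have := @ge0_integral_pushforward _ _ _ _ R _ mh1 m1 _ g measurableT mg g0'.
have := @ge0_integral_pushforward _ _ _ _ R _ mh2 m2 _ g measurableT mg g0'.
rewrite !preimage_setT /= => <- <-.
by apply: eq_measure_integral => B mB _; exact: m12.
Qed.
End EqIntegral.

Section Iterates.
Context {R : realType} {d : measure_display} {T : measurableType d}.
Variable Q : R.-pker T ~> T.
Local Open Scope ereal_scope.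
Local Notation W := (powspace tree T).
Implicit Types (h : T -> \bar R).

Fixpoint kernel_iter (n : nat) h (t : T) : \bar R :=
  if n is m.+1 then \int[Q t]_y kernel_iter m h y else h t.

Lemma kernel_iter_ge0 n h t : (forall y, 0 <= h y) -> 0 <= kernel_iter n h t.
Proof.
by move=> h0; elim: n t => //= n IH t; apply: integral_ge0.
Qed.

Lemma measurable_kernel_iter n h : (forall y, 0 <= h y) ->
  measurable_fun setT h -> measurable_fun setT (kernel_iter n h).
Proof.
move=> h0 mh; elim: n => //= n IH.
apply: measurable_fun_integral_kernel => // [U mU|t].
  exact: measurable_kernel.
exact: kernel_iter_ge0.
Qed.

Lemma kpow_indic n t A :
  kpow Q n t A = kernel_iter n (fun y => (\1_A y)%:E) t.
Proof. by elim: n t => //= n IH t; apply: eq_integral => y _; exact: IH. Qed.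

(** The other vertices of each generation are invisible to the integrand, so
    only the chain along the path [b] remains. *)
Lemma kernel_int_path b h (x : tree -> T) :
  kernel_int Q (levels 1 (size b)) (fun z => h (z b)) x =
  kernel_iter (size b) h (x [::]).
Proof.
elim: b x => // c b IH x.
have levelsS : levels 1 (size b).+1 = words 1 ++ levels 2 (size b) by [].
rewrite [size _]/= levelsS kernel_int_cat.
rewrite (@eq_kernel_int _ _ _ _ _ _
    (fun z => kernel_iter (size b) h (z [:: c]))) => [|z].
  case: c => /=; first by rewrite integral_pker_cst.
  by apply: eq_integral => y _; rewrite integral_pker_cst.
have := @kernel_int_translate _ _ _ Q (levels 2 (size b)) [:: c]
  (fun z => h (z b)) z.
rewrite -[2%N]/(size [:: c] + 1)%N levels_below IH => <- //.
by move=> u; rewrite in_levels; case/andP.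
Qed.

(** The conditional mean, given the value [t] at the root, of a function of
    the coordinates of height at most [k]. All coordinates are set to [t], but
    those above the root are overwritten. *)
Definition root_int (k : nat) (F : (tree -> T) -> \bar R) (t : T) : \bar R :=
  kernel_int Q (levels 1 k) F (fun=> t).

(** Conditional mean of a block based at [c ++ b] given the generations up to
    that of [c]: first the generations above the base by
    [kernel_int_translate], which leave a function of the value at the base,
    then the path from [c] to the base. *)
Lemma kernel_int_block k F c b m (x : tree -> T) :
    depends_on (below k) F -> (size b + k <= m)%N ->
  kernel_int Q (levels (size c).+1 m) (F \o translate (c ++ b)) x =
  kernel_iter (size b) (root_int k F) (x c).
Proof.
move=> Fk /subnKC <-; rewrite levelsD kernel_int_cat.
have translate_cat (y : tree -> T) :
    translate (c ++ b) y = translate b (translate c y).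
  by apply/funext => v; rewrite /translate catA.
transitivity (kernel_int Q (levels (size c).+1 (size b + k))
   ((F \o translate b) \o translate c) x).
  apply: eq_kernel_int => y.
  rewrite (@kernel_int_independent _ _ _ _ _
    (below (size c + size b + k))).
  - by rewrite /= translate_cat.
  - move=> z z' zz' /=; apply: Fk => u /= uk.
    by rewrite /translate zz'//= !size_cat leq_add2l.
  - by move=> u; rewrite in_levels addSn addnA -ltnNge => /andP[].
rewrite kernel_int_translate; last by move=> u; rewrite in_levels; case/andP.
rewrite -addn1 levels_below levelsD kernel_int_cat.
rewrite (@eq_kernel_int _ _ _ _ _ _ (fun z => root_int k F (z b))).
  by rewrite kernel_int_path /translate cats0.
move=> z; rewrite kernel_int_translate; last first.
  by move=> u; rewrite in_levels add1n; case/andP.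
rewrite addnC levels_below.
apply: (@depends_on_kernel_int_levels _ _ _ Q 0) => // u /=.
by rewrite leqn0 size_eq0 => /eqP ->; rewrite /translate cats0.
Qed.

Lemma root_int_ge0 k F t : (forall z, 0 <= F z) -> 0 <= root_int k F t.
Proof. exact: kernel_int_ge0. Qed.

Lemma measurable_root_int k F : (forall z, 0 <= F z) ->
  measurable_fun [set: W] F -> measurable_fun setT (root_int k F).
Proof.
move=> F0 mF; apply: (measurableT_comp (measurable_kernel_int _ _ F0 mF)).
by apply: measurable_powspace => u; exact: measurable_id.
Qed.

End Iterates.

Section Law.
Context {R : realType} {d : measure_display} {T : measurableType d}.
Variables (Q : R.-pker T ~> T) (nu : probability T R).
Context {d' : measure_display} {Omega : measurableType d'}.
Variables (P : probability Omega R) (X : tree -> {RV P >-> T}).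
Hypothesis X_bmc : branching_markov_chain nu Q X.
Local Open Scope ereal_scope.
Local Notation W := (powspace tree T).

Definition path_of (w : Omega) : tree -> T := fun u => X u w.

Lemma measurable_path_of : measurable_fun setT (path_of : Omega -> W).
Proof. by apply: measurable_powspace => u; exact: measurable_funP. Qed.

(** The initial law is treated as a constant kernel from the one-point space,
    so that averaging over it is again a composition of kernels. *)
Lemma pker_average_repr {d1 d2 : measure_display} (Y : measurableType d1)
    (Z : measurableType d2) (m : R.-pker Y ~> Z) (h : T -> Y) :
    measurable_fun setT h ->
  exists m' : {measure set Z -> \bar R}, forall g, (forall z, 0 <= g z) ->
    measurable_fun setT g -> \int[nu]_t \int[m (h t)]_z g z = \int[m']_z g z.
Proof.
move=> mh.
have mh2 : measurable_fun setT (h \o snd : unit * T -> Y).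
  exact: measurableT_comp.
have [m' m'E] := pker_comp
  (kprobability (@measurable_cst _ _ unit _ setT (nu : pprobability T R)))
  (kcomap m mh2).
by exists (m' tt) => g g0 mg; rewrite m'E.
Qed.

(** The chain and the iterated integral have the same image law under
    restriction to [Tlt n.+1]. A function [g] of these coordinates factors
    through the restriction, composed with an arbitrary extension [ext] by a
    default value. *)
Lemma integral_law (n : nat) (g : (tree -> T) -> \bar R) :
    (forall z, 0 <= g z) -> measurable_fun [set: W] g ->
    depends_on (below n) g ->
  \int[P]_w g (path_of w) =
  \int[nu]_t kernel_int Q (levels 1 n) g (fun=> t).
Proof.
move=> g0 mg gn.
have [m mE] := kernel_int_repr Q (levels 1 n).
have [|m' m'E] := pker_average_repr m (h := fun t => (fun=> t) : W).
  by apply: measurable_powspace => u; exact: measurable_id.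
under [RHS]eq_integral do rewrite mE//.
rewrite m'E//.
pose restr (z : W) : powspace (Tlt n.+1) T := fun v => z (val v).
pose ext (y : powspace (Tlt n.+1) T) : W :=
  fun u => if insub u is Some v then y v else point.
have mrestr : measurable_fun setT restr.
  by apply: measurable_powspace => v; exact: measurable_coord.
have mext : measurable_fun setT ext.
  apply: measurable_powspace => u; rewrite /ext.
  by case: insub => [v|]; [exact: measurable_coord|exact: measurable_cst].
have gE z : g z = g (ext (restr z)).
  apply: gn => u /= un; rewrite /ext /restr insubT/= ?in_Tlt ?ltnS//.
rewrite (eq_integral (fun w => (g \o ext) (restr (path_of w)))); last first.
  by move=> w _; rewrite gE.
rewrite [RHS](eq_integral (fun z => (g \o ext) (restr z))); last first.
  by move=> z _; rewrite [LHS]gE.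
apply: (@eq_law_integral _ _ _ _ _ _ _ P m' (restr \o path_of) restr) => //.
- by apply: measurableT_comp => //; exact: measurable_path_of.
- move=> B mB; rewrite [LHS]X_bmc//.
  pose gB (z : W) : \bar R := (\1_B (restr z))%:E.
  have gB0 z : 0 <= gB z by rewrite lee_fin.
  have mgB : measurable_fun setT gB.
    apply/measurable_EFinP.
    have mB1 : measurable_fun setT (\1_B : _ -> R) by exact: measurable_indic.
    exact: (measurableT_comp mB1 mrestr).
  under eq_integral do rewrite (mE _ gB)//.
  rewrite m'E// -[X in _ = m' X]setIT -integral_indic//; last first.
    by rewrite -[X in measurable X]setTI; exact: mrestr.
- by move=> y; exact: g0.
- exact: measurableT_comp.
Qed.

(** The integral over generations [1] to [n + m] splits, and the inner part is
    itself a function of the generations up to [n], to which [integral_law]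
    applies again. *)
Lemma integral_markov (n m : nat) (g : (tree -> T) -> \bar R) :
    (forall z, 0 <= g z) -> measurable_fun [set: W] g ->
    depends_on (below (n + m)) g ->
  \int[P]_w g (path_of w) =
  \int[P]_w kernel_int Q (levels n.+1 m) g (path_of w).
Proof.
move=> g0 mg gnm; rewrite (integral_law g0 mg gnm) (@integral_law n).
- by apply: eq_integral => t _; rewrite levelsD kernel_int_cat.
- by move=> z; exact: kernel_int_ge0.
- exact: measurable_kernel_int.
- exact: depends_on_kernel_int_levels.
Qed.

End Law.

(** * Total variation and invariance *)

Section AsProbability.
Context {R : realType} {d : measure_display} {T : measurableType d}.
Variable m : {measure set T -> \bar R}.

Definition as_probability (mT : m setT = 1%E) : set T -> \bar R := m.

Hypothesis mT : m setT = 1%E.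
HB.instance Definition _ := Measure.on (as_probability mT).
HB.instance Definition _ :=
  Measure_isProbability.Build _ _ _ (as_probability mT) mT.
End AsProbability.

Section TotalVariation.
Context {R : realType} {d : measure_display} {T : measurableType d}.
Local Open Scope ereal_scope.

Lemma measurable_indicE d' (U : measurableType d') (D A : set U) :
  measurable A -> measurable_fun D (fun x => (\1_A x)%:E : \bar R).
Proof. by move=> mA; apply/measurable_EFinP; exact: measurable_indic. Qed.

Lemma measurable_scaled_indic d' (U : measurableType d') (D A : set U) (c : R) :
  measurable A -> measurable_fun D (fun x => (c * \1_A x)%:E : \bar R).
Proof.
by move=> mA; apply/measurable_EFinP; exact: measurable_funM.
Qed.

(** Layer-cake formula: the integral of [h] is the integral over [r >= 0] of
    the measure of [[set t | h t > r]], and only the levels [r <= K]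
    contribute. *)
Lemma integral_le_of_setwise_le (m1 m2 : probability T R) (delta K : R)
    (h : T -> R) :
    measurable_fun setT h -> (0 <= delta)%R ->
    (forall t, 0 <= h t)%R -> (forall t, h t <= K)%R ->
    (forall A, measurable A -> m1 A <= m2 A + delta%:E) ->
  \int[m1]_t (h t)%:E <= \int[m2]_t (h t)%:E + (K * delta)%:E.
Proof.
move=> mh d0 h0 hK m12.
have K0 : (0 <= K)%R by exact: le_trans (h0 point) (hK point).
pose X : {mfun T >-> R} := HB.pack h (isMeasurableFun.Build _ _ _ _ _ mh).
pose mu : {measure set _ -> \bar R} := @lebesgue_measure R.
have EX (m : probability T R) : \int[m]_t (h t)%:E =
    \int[mu]_(r in `[0%R, +oo[) ccdf (X : {RV m >-> R}) r.
  by rewrite -ge0_expectation_ccdf// unlock.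
rewrite !EX.
have -> : (K * delta)%:E = \int[mu]_(r in `[0%R, +oo[)
    (delta * \1_(`[0%R, K] : set R) r)%:E.
  under eq_integral do rewrite EFinM.
  rewrite ge0_integralZl//; last first.
    by apply: measurable_indicE.
  rewrite integral_indic//= setIidl; last first.
    by move=> r /=; rewrite !in_itv/= => /andP[->].
  by rewrite /mu lebesgue_measure_itv/= lte_fin; case: ltgtP K0 => // [_|<-] _;
    rewrite ?oppr0 ?adde0 ?sube0 ?mule0 ?mul0r// mulrC -EFinM.
have bump0 r : 0 <= (delta * \1_(`[0%R, K] : set R) r)%:E.
  by rewrite lee_fin mulr_ge0.
have mccdf (m : probability T R) :
    @measurable_fun _ _ (measurableTypeR R) _ setT (ccdf (X : {RV m >-> R})).
  by move=> mT A mA; exact: (ccdf_measurable (X : {RV m >-> R}) mT mA).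
have mbump : @measurable_fun _ _ (measurableTypeR R) _ `[0%R, +oo[%classic
    (fun r => (delta * \1_(`[0%R, K] : set R) r)%:E).
  by apply: (@measurable_scaled_indic _ (measurableTypeR R)).
rewrite -ge0_integralD//; last by apply: (measurable_funTS (mccdf m2)).
apply: ge0_le_integral => //.
- by apply: (measurable_funTS (mccdf m1)).
- by apply: emeasurable_funD => //; apply: (measurable_funTS (mccdf m2)).
move=> r; rewrite /= in_itv/= andbT => r0.
have mA : measurable (h @^-1` `]r, +oo[%classic).
  by rewrite -[X in measurable X]setTI; apply: (mh measurableT).
have [rK|Kr] := leP r K.
  rewrite indicE mem_set ?mulr1; last by rewrite /= in_itv/= r0.
  exact: m12.
rewrite (_ : ccdf _ r = 0); last first.
  rewrite /ccdf /distribution /pushforward/= (_ : _ @^-1` _ = set0) ?measure0//.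
  apply/seteqP; split => // t /=; rewrite in_itv/= andbT => rt.
  by move: (lt_trans Kr rt); rewrite ltNge hK.
by rewrite adde_ge0// lee_fin mulr_ge0.
Qed.
End TotalVariation.

Section Ergodic.
Context {R : realType} {d : measure_display} {T : measurableType d}.
Variable Q : R.-pker T ~> T.
Local Open Scope ereal_scope.

Lemma kernel_iter_repr n : exists m : R.-pker T ~> T, forall t h,
    (forall y, 0 <= h y) -> measurable_fun setT h ->
  kernel_iter Q n h t = \int[m t]_y h y.
Proof.
elim: n => [|n [m mE]].
  exists (kdirac (@measurable_id _ T setT)) => t h h0 mh.
  by rewrite integral_dirac//= diracT mul1e.
have [m' m'E] := pker_comp Q
  (kcomap m (measurable_snd : measurable_fun setT (snd : T * T -> T))).
exists m' => t h h0 mh; rewrite m'E//=.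
by apply: eq_integral => y _; rewrite mE.
Qed.

(** Only the upper bound is stated: a variance is nonnegative, so bounding
    covariances from above suffices. *)
Lemma kernel_iter_le (pi : probability T R) (delta K : R) n t (h : T -> \bar R) :
    tv_dist (kpow Q n t) pi <= delta%:E ->
    measurable_fun setT h -> (forall y, 0 <= h y) -> (forall y, h y <= K%:E) ->
  kernel_iter Q n h t <= \int[pi]_y h y + (K * delta)%:E.
Proof.
move=> tv mh h0 hK; have [m mE] := kernel_iter_repr n.
have hE y : h y = (fine (h y))%:E.
  by rewrite fineK// ge0_fin_numE// (le_lt_trans (hK y)) ?ltry.
rewrite mE//; under eq_integral do rewrite hE.
under [in leRHS]eq_integral do rewrite hE.
have mt1 : m t setT = 1 by exact: prob_kernel.
have mB A : measurable A -> m t A = kpow Q n t A.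
  move=> mA; rewrite kpow_indic mE//; first by rewrite integral_indic// setIT.
  exact: measurable_indicE.
have delta0 : (0 <= delta)%R.
  rewrite -lee_fin (le_trans _ tv)//.
  apply: (@le_trans _ _ `|kpow Q n t set0 - pi set0|).
    exact: abse_ge0.
  by rewrite /tv_dist; apply: ereal_sup_ubound; exists set0.
apply: (@integral_le_of_setwise_le _ _ _ (as_probability mt1)) => //.
- apply/measurable_EFinP; rewrite (_ : _ \o _ = h)//.
  by apply/funext => y; rewrite /= -hE.
- by move=> y; rewrite fine_ge0.
- by move=> y; rewrite -lee_fin -hE.
move=> A mA; change (m t A <= pi A + delta%:E); rewrite mB//.
have : `|kpow Q n t A - pi A| <= delta%:E.
  by apply: le_trans tv; rewrite /tv_dist; apply: ereal_sup_ubound; exists A.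
have : kpow Q n t A \is a fin_num 
  by rewrite -mB//; exact: (fin_num_measure (as_probability mt1)).
have : pi A \is a fin_num by exact: fin_num_measure.
case: (pi A) (kpow Q n t A) => [a||] [b||] // _ _.
rewrite -EFinB abse_EFin !lee_fin ler_norml => /andP[_].
by rewrite lerBlDl.
Qed.

Variable pi : probability T R.
Hypothesis Q_pi : invariant_proba Q pi.

Lemma invariant_integral (h : T -> \bar R) : (forall y, 0 <= h y) ->
    measurable_fun setT h ->
  \int[pi]_t \int[Q t]_y h y = \int[pi]_y h y.
Proof.
move=> h0 mh; have [m mE] := pker_average_repr pi Q (@measurable_id _ T setT).
rewrite mE//; apply: eq_measure_integral => A mA _.
rewrite -[X in m X]setIT -integral_indic// -mE//; last exact: measurable_indicE.
transitivity (\int[pi]_x Q x A); last exact: Q_pi.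
apply: eq_integral => t _.
by rewrite integral_indic// setIT.
Qed.

Lemma invariant_kernel_iter n (h : T -> \bar R) : (forall y, 0 <= h y) ->
    measurable_fun setT h ->
  \int[pi]_t kernel_iter Q n h t = \int[pi]_y h y.
Proof.
move=> h0 mh; elim: n => //= n IH.
rewrite invariant_integral//; last exact: measurable_kernel_iter.
by move=> y; exact: kernel_iter_ge0.
Qed.

End Ergodic.

(** * Decorrelation of blocks in disjoint subtrees *)

Section Decorrelation.
Context {R : realType} {d : measure_display} {T : measurableType d}.
Variables (Q : R.-pker T ~> T) (pi : probability T R).
Hypothesis Q_pi : invariant_proba Q pi.
Context {d' : measure_display} {Omega : measurableType d'}.
Variables (P : probability Omega R) (X : tree -> {RV P >-> T}).
Hypothesis X_bmc : branching_markov_chain pi Q X.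
Local Open Scope ereal_scope.
Local Notation W := (powspace tree T).
Implicit Types (F : (tree -> T) -> \bar R).

Lemma measurable_comp_translate F a : measurable_fun [set: W] F ->
  measurable_fun [set: W] (F \o translate a).
Proof.
by move=> mF; apply: (measurableT_comp mF); exact: measurable_translate.
Qed.

Lemma depends_on_translate F k a : depends_on (below k) F ->
  depends_on [pred u : tree | prefix a u && (size u <= size a + k)%N]
    (F \o translate a).
Proof.
move=> Fk x y xy; apply: Fk => u /= uk; rewrite /translate xy//=.
by rewrite prefix_prefix size_cat leq_add2l.
Qed.

(** The block is integrated down to its base, and the base has law [pi] by
    invariance. *)
Lemma integral_stationary k F a : (forall z, 0 <= F z) ->
    measurable_fun [set: W] F -> depends_on (below k) F ->
  \int[P]_w F (translate a (path_of X w)) = \int[pi]_t root_int Q k F t.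
Proof.
move=> F0 mF Fk.
rewrite (integral_law (n := size a + k) X_bmc (g := F \o translate a))//.
- under eq_integral do rewrite (@kernel_int_block _ _ _ Q k F [::] a)//.
  rewrite (@invariant_kernel_iter _ _ _ Q pi Q_pi)//.
  + by move=> t; exact: root_int_ge0.
  + exact: measurable_root_int.
- by move=> z; exact: F0.
- exact: measurable_comp_translate.
- by apply: (sub_depends_on _ (depends_on_translate (a := a) Fk)) => u /= /andP[].
Qed.

Lemma kernel_int_le s F (K : R) (x : tree -> T) : (forall z, 0 <= F z) ->
  measurable_fun [set: W] F -> (forall z, F z <= K%:E) ->
  kernel_int Q s F x <= K%:E.
Proof.
move=> F0 mF FK; have [m mE] := kernel_int_repr Q s; rewrite mE//.
apply: (@le_trans _ _ (\int[m x]_z K%:E)).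
  exact: ge0_le_integral.
by rewrite integral_cst// prob_kernel mule1.
Qed.

(** Given the generations up to that of [c1] and [c2], the two blocks are
    independent, and the first one has conditional mean at most its mean plus
    [K * delta]; the second conditional mean is nonnegative and averages to
    its mean. *)
Lemma decorrelation k F1 F2 (K delta : R) c1 c2 b1 b2 :
    (forall z, 0 <= F1 z) -> (forall z, 0 <= F2 z) ->
    measurable_fun [set: W] F1 -> measurable_fun [set: W] F2 ->
    depends_on (below k) F1 -> depends_on (below k) F2 ->
    (forall z, F1 z <= K%:E) ->
    size c1 = size c2 -> c1 != c2 ->
    (forall t, tv_dist (kpow Q (size b1) t) pi <= delta%:E) ->
  \int[P]_w (F1 (translate (c1 ++ b1) (path_of X w)) *
             F2 (translate (c2 ++ b2) (path_of X w))) <=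
  (\int[pi]_t root_int Q k F1 t + (K * delta)%:E) *
  \int[pi]_t root_int Q k F2 t.
Proof.
move=> F10 F20 mF1 mF2 F1k F2k F1K c12 nc12 tv.
(* [m] generations after that of [c1] and [c2] contain both blocks *)
set n := size c1; pose m := (maxn (size b1) (size b2) + k)%N.
pose g1 := F1 \o translate (c1 ++ b1); pose g2 := F2 \o translate (c2 ++ b2).
have mg1 : measurable_fun [set: W] g1 by exact: measurable_comp_translate.
have mg2 : measurable_fun [set: W] g2 by exact: measurable_comp_translate.
have sub (i : (tree -> T) -> \bar R) c b : (size c = n ->
    size b <= maxn (size b1) (size b2) ->
    depends_on (below k) i ->
    depends_on (below (n + m)) (i \o translate (c ++ b)) /\
    depends_on (prefix c) (i \o translate (c ++ b)))%N.
  move=> cn bm ik; split;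
    apply: (sub_depends_on _ (depends_on_translate (a := c ++ b) ik)) => u /=.
  + case/andP=> _ /leq_trans; apply.
    by rewrite size_cat cn -addnA leq_add2l leq_add2r.
  + case/andP => + _.
    by move/prefixP => [s ->]; rewrite -catA prefix_prefix.
have [g1n g1c] := sub F1 c1 b1 erefl (leq_maxl _ _) F1k.
have [g2n g2c] := sub F2 c2 b2 (esym c12) (leq_maxr _ _) F2k.
have g10 z : 0 <= g1 z by exact: F10.
have g20 z : 0 <= g2 z by exact: F20.
have H10 t : 0 <= root_int Q k F1 t by exact: root_int_ge0.
have H20 t : 0 <= root_int Q k F2 t by exact: root_int_ge0.
have mH1 := measurable_root_int Q k F10 mF1.
have mH2 := measurable_root_int Q k F20 mF2.
have E1 x : kernel_int Q (levels n.+1 m) g1 x =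
    kernel_iter Q (size b1) (root_int Q k F1) (x c1).
  by rewrite (@kernel_int_block _ _ _ Q k F1 c1 b1 m)// leq_add2r leq_maxl.
have E2 x : kernel_int Q (levels n.+1 m) g2 x =
    kernel_iter Q (size b2) (root_int Q k F2) (x c2).
  by rewrite /n c12 (@kernel_int_block _ _ _ Q k F2 c2 b2 m)// leq_add2r leq_maxr.
have prefix_parent c u : size c = n -> u \in levels n.+1 m -> prefix c u ->
    prefix c (parent u).
  move=> cn; rewrite in_levels => /andP[nu _] /prefixP[s us].
  rewrite us parent_cat ?prefix_prefix//.
  by apply: contraTneq nu => s0; rewrite us s0 cats0 cn ltnn.
have -> : \int[P]_w (F1 (translate (c1 ++ b1) (path_of X w)) *
                     F2 (translate (c2 ++ b2) (path_of X w))) =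
    \int[P]_w (kernel_int Q (levels n.+1 m) g1 (path_of X w) *
               kernel_int Q (levels n.+1 m) g2 (path_of X w)).
  rewrite (integral_markov (n := n) (m := m) X_bmc (g := fun z => g1 z * g2 z)).
  - apply: eq_integral => w _.
    apply: (@kernel_int_prod _ _ _ _ _ (prefix c1) (prefix c2)) => //.
    + by move=> u um; exact: prefix_parent.
    + by move=> u um; exact: prefix_parent.
    move=> u _; apply/negP => /andP[/prefixP[s1 us1] /prefixP[s2 us2]].
    move/eqP: nc12; apply; move: us2; rewrite us1 => /eqP.
    by rewrite eqseq_cat// => /andP[/eqP].
  - by move=> z; exact: mule_ge0.
  - exact: emeasurable_funM.
  - by move=> x y xy; congr (_ * _); [exact: g1n|exact: g2n].
have -> : \int[pi]_t root_int Q k F2 t =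
    \int[P]_w kernel_int Q (levels n.+1 m) g2 (path_of X w).
  rewrite -(integral_stationary (c2 ++ b2))//.
  exact: (integral_markov (n := n) (m := m) X_bmc (g := g2)).
have mpath := measurable_path_of X.
have mK g : (forall z, 0 <= g z) -> measurable_fun [set: W] g ->
    measurable_fun setT (fun w => kernel_int Q (levels n.+1 m) g (path_of X w)).
  move=> g0 mg.
  exact: (measurableT_comp (measurable_kernel_int Q (levels n.+1 m) g0 mg) mpath).
have c0 : 0 <= \int[pi]_t root_int Q k F1 t + (K * delta)%:E.
  apply: (@le_trans _ _ (kernel_iter Q (size b1) (root_int Q k F1) point)).
    exact: kernel_iter_ge0.
  by apply: kernel_iter_le => // y; exact: kernel_int_le.
rewrite -ge0_integralZl//; last 2 first.
- exact: mK.
- by move=> w _; exact: kernel_int_ge0.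
apply: ge0_le_integral => //.
- by move=> w _; rewrite mule_ge0//; exact: kernel_int_ge0.
- by apply: emeasurable_funM; exact: mK.
- by apply: measurable_funeM; exact: mK.
move=> w _; apply: lee_wpmul2r; first exact: kernel_int_ge0.
rewrite E1; apply: kernel_iter_le => // y; exact: kernel_int_le.
Qed.

End Decorrelation.

(** * Words and breadth-first order *)

Lemma size_words n : size (words n) = (2 ^ n)%N.
Proof.
elim: n => //= n IH; rewrite !size_cat !size_map IH addn0.
by rewrite expnS mul2n addnn.
Qed.

Lemma uniq_words n : uniq (words n).
Proof.
elim: n => //= n IH; rewrite cats0 cat_uniq !map_inj_uniq ?IH; last 2 first.
- by move=> u v [].
- by move=> u v [].
rewrite andbT; apply/hasPn => u /mapP[v _ ->].
by apply/negP => /mapP[].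
Qed.

Lemma size_levels0 n : (size (levels 0 n) <= 2 ^ n)%N.
Proof.
elim: n => // n IH; rewrite -addn1 levelsD size_cat add0n.
rewrite (_ : levels n 1 = words n); last by rewrite /levels /= cats0.
by rewrite size_words addn1 expnS mul2n -addnn leq_add2r.
Qed.

Lemma bfs_leE u v : bfs_le u v = (u == v) || bfs_lt u v.
Proof.
rewrite /bfs_lt; have [->|//] := eqVneq u v.
by rewrite /bfs_le eqxx lexx orbT.
Qed.

Lemma bfs_le_size u v : bfs_le u v -> (size u <= size v)%N.
Proof. by case/orP=> [/ltnW//|/andP[/eqP ->]]. Qed.

(** The lexicographic order compares words of different lengths too; for
    prefixes of equal length it reduces to comparing them first. *)
Lemma lexi_cat (a a' w w' : seqlexi bool) : size a = size a' ->
  ((a ++ w : seqlexi bool) <= (a' ++ w' : seqlexi bool))%O =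
  if a == a' then (w <= w')%O else (a <= a')%O.
Proof.
elim: a a' => [|b a IH] [|b' a'] //= [/IH e].
rewrite !lexi_cons e eqseq_cons.
by case: b b' => [] [] //=; case: (a == a').
Qed.

Lemma bfs_le_cat a a' w w' : size w = size w' ->
  bfs_le (a ++ w) (a' ++ w') = bfs_lt a a' || (a == a') && bfs_le w w'.
Proof.
move=> ww; rewrite /bfs_lt /bfs_le !size_cat ww ltn_add2r eqn_add2r.
rewrite ltnn eqxx /=; case: ltngtP => [aa|aa|aa] /=.
- by have /negPf -> : a != a' by apply: contraTneq aa => ->; rewrite ltnn.
- by have /negPf -> : a != a' by apply: contraTneq aa => ->; rewrite ltnn.
by rewrite lexi_cat//; case: (a == a') => /=; rewrite ?orbF.
Qed.

Lemma mem_ball (k : nat) (z u : tree) :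
  (u \in Delta_full z `\` Tlt k) = (k <= size u)%N && bfs_le u z.
Proof. by rewrite in_fsetD in_Tlt -leqNgt in_Delta_full bfs_leE. Qed.

(** In the breadth-first order the vertices [b ++ w'] with [b] fixed are
    consecutive. So the words are complete for the [b] strictly before [a],
    and are cut at [w] for [b = a]. *)
Lemma ball_blocks (k : nat) (a w : tree) : size w = k ->
  perm_eq (Delta_full (a ++ w) `\` Tlt k)
    ([seq b ++ w' | b <- Delta_star a (size a), w' <- words k] ++
     [seq a ++ w' | w' <- words k & bfs_le w' w]).
Proof.
move=> sw.
have mem_a b : (b \in Delta_star a (size a)) = bfs_lt b a.
  by rewrite in_Delta_star ancE subnn take0 prefix0s.
apply: uniq_perm; first exact: fset_uniq.
  rewrite cat_uniq; apply/and3P; split.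
  - apply: allpairs_uniq; [exact: fset_uniq|exact: uniq_words|].
    move=> [b1 w1] [b2 w2] /allpairsP[[b1' w1'] /= [_ + [-> ->]]].
    rewrite in_words => /eqP s1.
    move=> /allpairsP[[b2' w2'] /= [_ + [-> ->]]].
    rewrite in_words => /eqP s2 e.
    have sb : size b1' = size b2'.
      by move/(congr1 size): e; rewrite !size_cat s1 s2 => /addIn.
    by move/eqP: e; rewrite eqseq_cat// => /andP[/eqP -> /eqP ->].
  - apply/hasPn => u /mapP[w1]; rewrite mem_filter in_words => /andP[_ /eqP s1] ->.
    apply/negP => /allpairsP[[b w2] /= [ba + e]]; rewrite in_words => /eqP s2.
    have sb : size a = size b.
      by move/(congr1 size): e; rewrite !size_cat s1 s2 => /addIn.
    move/eqP: e; rewrite eqseq_cat// => /andP[/eqP ab _].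
    by move: ba; rewrite mem_a -ab /bfs_lt eqxx.
  - rewrite map_inj_uniq; first by rewrite filter_uniq// uniq_words.
    by move=> w1 w2 /eqP; rewrite eqseq_cat// eqxx => /eqP.
move=> u; rewrite mem_ball mem_cat; apply/idP/idP.
  move=> /andP[ku]; rewrite -{1}(cat_take_drop (size u - k) u).
  set b := take _ _; set w' := drop _ _.
  have sw' : size w' = k by rewrite size_drop subKn.
  have uE : u = b ++ w' by rewrite cat_take_drop.
  rewrite bfs_le_cat ?sw'// => /orP[lt_ba|/andP[/eqP ba le_w]].
    apply/orP; left; apply/allpairsP; exists (b, w'); split => //=.
      by rewrite mem_a.
    by rewrite in_words sw'.
  apply/orP; right; apply/mapP; exists w'; last by rewrite -ba.
  by rewrite mem_filter le_w in_words sw' eqxx.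
case/orP.
  move=> /allpairsP[[b w'] /= [+ + ->]]; rewrite mem_a in_words => lt_ba /eqP sw'.
  by rewrite size_cat sw' leq_addl bfs_le_cat ?sw'// lt_ba.
move=> /mapP[w']; rewrite mem_filter in_words => /andP[le_w /eqP sw'] ->.
by rewrite size_cat sw' leq_addl bfs_le_cat ?sw'// le_w eqxx orbT.
Qed.

Lemma drop_cat_word k (b w : tree) : size w = k ->
  drop (size (b ++ w) - k) (b ++ w) = w.
Proof. by move=> <-; rewrite size_cat addnK drop_size_cat. Qed.

(** By [ball_blocks] the sum consists of complete runs over the words, which
    contribute exactly the average of [g], and of one incomplete run. *)
Lemma word_frequency {R : realType} (g : tree -> R) k z : (k <= size z)%N ->
  `|\sum_(u <- Delta_full z `\` Tlt k) g (drop (size u - k) u) -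
    #|` Delta_full z `\` Tlt k|%:R * ((2 ^ k)%:R^-1 * \sum_(w <- words k) g w)|
  <= 2 * \sum_(w <- words k) `|g w|.
Proof.
move=> kz; have sw : size (drop (size z - k) z) = k by rewrite size_drop subKn.
have := ball_blocks (take (size z - k) z) sw; rewrite cat_take_drop.
set A := Delta_full z `\` Tlt k; set a := take _ z; set w := drop _ z => AE.
set G := \sum_(w' <- words k) g w'.
rewrite (perm_big _ AE) (perm_size AE) size_cat size_allpairs size_map size_words.
rewrite big_cat big_allpairs_dep big_map /=.
have wordE b : \sum_(w' <- words k) g (drop (size (b ++ w') - k) (b ++ w')) = G.
  apply: eq_big_seq => w' w'k; rewrite drop_cat_word//.
  by move: w'k; rewrite in_words => /eqP.
under eq_bigr do rewrite wordE.
rewrite big_const_seq count_predT iter_addr_0 size_filter.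
set m := size _; set c := count _ _.
set S := (X in `|_ + X - _|).
have SE : S = \sum_(w' <- words k | bfs_le w' w) g w'.
  rewrite -[RHS]big_filter; apply: eq_big_seq => w'.
  by rewrite mem_filter in_words => /andP[_ /eqP sw']; rewrite drop_cat_word.
have ck : (c <= 2 ^ k)%N by rewrite -size_words count_size.
have k0 : (2 ^ k)%:R != 0 :> R by rewrite pnatr_eq0 expn_eq0.
have G_le : `|G| <= \sum_(w' <- words k) `|g w'| by exact: ler_norm_sum.
have S_le : `|S| <= \sum_(w' <- words k) `|g w'|.
  rewrite SE (le_trans (ler_norm_sum _ _ _))// [leRHS](bigID (bfs_le^~ w))/=.
  by rewrite lerDl sumr_ge0.
have -> : G *+ m + S - (m * 2 ^ k + c)%:R * ((2 ^ k)%:R^-1 * G) =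
          S - (c%:R / (2 ^ k)%:R) * G.
  by rewrite natrD natrM -mulr_natr; field.
apply: le_trans (ler_normB _ _) _; rewrite mulr2n mulrDl mul1r lerD//.
rewrite normrM (le_trans _ G_le)// ler_piMl//.
rewrite ger0_norm ?divr_ge0// ler_pdivrMr ?mul1r ?ler_nat//.
Qed.

Lemma count_low k z n :
  (count (fun u => size u < n) (Delta_full z `\` Tlt k) <= 2 ^ n)%N.
Proof.
rewrite -size_filter; apply: leq_trans (size_levels0 n).
apply: uniq_leq_size; first by rewrite filter_uniq// fset_uniq.
by move=> u; rewrite mem_filter in_levels => /andP[].
Qed.

(** A vertex is determined by its ancestor at height [n] and the remaining
    word, whose length is at most [size z - n]. *)
Lemma count_same_ancestor k z n c : (n <= size z)%N ->
  (count (fun u => take n u == c) (Delta_full z `\` Tlt k) <=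
   2 ^ ((size z).+1 - n))%N.
Proof.
move=> nz; rewrite -size_filter -(size_map (drop n)).
apply: leq_trans (size_levels0 _); apply: uniq_leq_size.
  rewrite map_inj_in_uniq ?filter_uniq ?fset_uniq// => u1 u2.
  rewrite !mem_filter => /andP[/eqP u1c _] /andP[/eqP u2c _] u12.
  by rewrite -(cat_take_drop n u1) -(cat_take_drop n u2) u1c u2c u12.
move=> _ /mapP[u + ->]; rewrite mem_filter mem_ball in_levels => /and3P[_ _ uz].
by rewrite add0n size_drop ltn_sub2r// ltnS//; exact: bfs_le_size.
Qed.

(** The whole generation before that of [z] is included. *)
Lemma card_ball_ge k z : (k < size z)%N ->
  (2 ^ (size z).-1 <= #|` Delta_full z `\` Tlt k|)%N.
Proof.
case zn: (size z) => [//|n]; rewrite ltnS => kn.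
rewrite -size_words; apply: uniq_leq_size (uniq_words _) _ => u.
by rewrite in_words mem_ball /bfs_le => /eqP ->; rewrite kn zn ltnSn.
Qed.

Lemma enumeration_size v : bfs_enumeration v ->
  forall l, exists n0, forall n, (n0 <= n)%N -> (l <= size (v n))%N.
Proof.
move=> [v_inc v_surj] l; have [n0 vn0] := v_surj (nseq l true).
exists n0 => n; rewrite leq_eqVlt => /orP[/eqP <-|/v_inc/bfs_lt_size].
  by rewrite vn0 size_nseq.
by rewrite vn0 size_nseq.
Qed.

(** * Second moments *)

Section RealInequalities.
Context {R : realType}.
Local Open Scope ring_scope.

Lemma sum_nat_of_bool (I : Type) (s : seq I) (p : pred I) :
  \sum_(i <- s) (p i)%:R = (count p s)%:R :> R.
Proof.
elim: s => [|i s IH]; first by rewrite big_nil.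
by rewrite big_cons IH /= natrD.
Qed.

Lemma le_divr_pow2 (c eta : R) : 0 < eta ->
  exists n0, forall n, (n0 <= n)%N -> c / (2 ^ n)%:R <= eta.
Proof.
move=> eta0; exists (Num.truncn (c / eta)).+1 => n n0n.
have pow0 : 0 < (2 ^ n)%:R :> R by rewrite ltr0n expn_gt0.
rewrite ler_pdivrMr// mulrC -ler_pdivrMr// ltW//.
rewrite (lt_le_trans (truncnS_gt _))// ler_nat (leq_trans n0n)//.
exact/ltnW/ltn_expl.
Qed.

Lemma sqr_sum4_le (a b c e : R) :
  (a + b + c + e) ^+ 2 <= 4 * (a ^+ 2 + b ^+ 2 + c ^+ 2 + e ^+ 2).
Proof.
rewrite -subr_ge0.
have -> : 4 * (a ^+ 2 + b ^+ 2 + c ^+ 2 + e ^+ 2) - (a + b + c + e) ^+ 2 =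
  (a - b) ^+ 2 + (a - c) ^+ 2 + (a - e) ^+ 2 + (b - c) ^+ 2 + (b - e) ^+ 2 +
  (c - e) ^+ 2 by ring.
by rewrite !addr_ge0 ?sqr_ge0.
Qed.

(** Cauchy-Schwarz, from [2 * z i * z j <= z i ^+ 2 + z j ^+ 2] summed over
    all pairs. *)
Lemma sqr_sum_le (I : Type) (s : seq I) (z : I -> R) :
  (\sum_(i <- s) z i) ^+ 2 <= (size s)%:R * \sum_(i <- s) z i ^+ 2.
Proof.
rewrite expr2 mulr_suml.
have -> : (size s)%:R * \sum_(i <- s) z i ^+ 2 =
    \sum_(i <- s) \sum_(j <- s) (z i ^+ 2 + z j ^+ 2) / 2.
  transitivity (\sum_(i <- s) ((z i ^+ 2 *+ size s + \sum_(j <- s) z j ^+ 2) / 2)).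
    rewrite -mulr_suml big_split/= big_const_seq count_predT iter_addr_0.
    by rewrite sumrMnl -mulr_natl; field.
  apply: eq_bigr => i _; rewrite -mulr_suml big_split/= big_const_seq.
  by rewrite count_predT iter_addr_0.
apply: ler_sum => i _; rewrite mulr_sumr; apply: ler_sum => j _.
by have := sqr_ge0 (z i - z j); nra.
Qed.

Definition cutoff (c y : R) : R := Num.max (- c) (Num.min c y).

Lemma sqr_sub_cutoff_le (c x : R) : 0 <= c ->
  (x - cutoff c x) ^+ 2 <= x ^+ 2.
Proof.
move=> c0; rewrite -subr_ge0 /cutoff; set t := Num.max _ _.
have -> : x ^+ 2 - (x - t) ^+ 2 = t * (2 * x - t) by ring.
rewrite /t; case: (leP c x) => h1; [case: (leP (- c) c)|case: (leP (- c) x)] => h2.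
- by apply: mulr_ge0 => //; lra.
- by apply: mulr_le0; lra.
- by rewrite (_ : x * _ = x ^+ 2) ?sqr_ge0//; ring.
- by apply: mulr_le0; lra.
Qed.

Lemma measurable_cutoff c : measurable_fun [set: R] (cutoff c).
Proof. by apply: measurable_maxr => //; exact: measurable_minr. Qed.

End RealInequalities.

Section SecondMoments.
Context {R : realType} {d : measure_display} {Omega : measurableType d}.
Variable P : probability Omega R.
Local Open Scope ereal_scope.

Lemma bounded_integral_le (Z : Omega -> R) (c : R) : measurable_fun setT Z ->
  (forall w, 0 <= Z w)%R -> (forall w, Z w <= c)%R ->
  \int[P]_w (Z w)%:E <= c%:E.
Proof.
move=> mZ Z0 Zc; apply: (@le_trans _ _ (\int[P]_w c%:E)).
  apply: ge0_le_integral => // [w _||w _]; rewrite ?lee_fin//.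
  exact/measurable_EFinP.
by rewrite integral_cst//= probability_setT mule1.
Qed.

(** Bienayme's formula with upper bounds for the covariances. Nonnegativity of
    the variables allows expanding the square without integrability
    conditions: the cross term is moved to the other side, so that only sums
    of nonnegative terms are integrated. *)
Lemma integral_sqr_sum_centered (I : Type) (s : seq I) (Y : I -> Omega -> R)
    (mean : I -> R) (b : I -> I -> R) :
    (forall i, measurable_fun setT (Y i)) -> (forall i w, (0 <= Y i w)%R) ->
    (forall i, \int[P]_w (Y i w)%:E = (mean i)%:E) ->
    (forall i j,
       \int[P]_w (Y i w * Y j w)%:E <= (mean i * mean j + b i j)%:E) ->
  \int[P]_w ((\sum_(i <- s) Y i w - \sum_(i <- s) mean i) ^+ 2)%:E <=
  (\sum_(i <- s) \sum_(j <- s) b i j)%:E.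
Proof.
move=> mY Y0 EY Yb.
pose S w := (\sum_(i <- s) Y i w)%R; pose mu := (\sum_(i <- s) mean i)%R.
have mS : measurable_fun setT S by exact: measurable_sum.
have S0 w : (0 <= S w)%R by rewrite sumr_ge0.
have mean0 i : (0 <= mean i)%R.
  by rewrite -lee_fin -EY integral_ge0// => w _; rewrite lee_fin.
have mu0 : (0 <= mu)%R by rewrite sumr_ge0.
have ES : \int[P]_w (S w)%:E = mu%:E.
  under eq_integral do rewrite /S -sumEFin.
  rewrite ge0_integral_sum//; last 2 first.
  - by move=> i; exact/measurable_EFinP.
  - by move=> i w _; rewrite lee_fin.
  by rewrite -sumEFin; apply: eq_bigr => i _; rewrite EY.
have ES2 : \int[P]_w (S w ^+ 2)%:E <=
    (mu ^+ 2 + \sum_(i <- s) \sum_(j <- s) b i j)%:E.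
  have S2 w : ((S w ^+ 2)%:E = \sum_(i <- s) \sum_(j <- s) (Y i w * Y j w)%:E).
    rewrite expr2 /S mulr_suml -sumEFin; apply: eq_bigr => i _.
    by rewrite mulr_sumr -sumEFin.
  under eq_integral do rewrite S2.
  have mYY i j : measurable_fun setT (fun w => (Y i w * Y j w)%:E).
    by apply/measurable_EFinP; exact: measurable_funM.
  have YY0 i j w : 0 <= (Y i w * Y j w)%:E by rewrite lee_fin mulr_ge0.
  rewrite ge0_integral_sum//; last 2 first.
  - by move=> i; exact: emeasurable_sum.
  - by move=> i w _; exact: sume_ge0.
  rewrite expr2 mulr_suml -big_split/= -sumEFin; apply: lee_sum => i _.
  rewrite ge0_integral_sum// mulr_sumr -big_split/= -sumEFin.
  exact: lee_sum.
(* [(S - mu) ^+ 2 + 2 * mu * S = S ^+ 2 + mu ^+ 2], integrated *)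
have key : \int[P]_w ((S w - mu) ^+ 2)%:E + (2 * mu * mu)%:E =
    \int[P]_w (S w ^+ 2)%:E + (mu ^+ 2)%:E.
  have -> : (2 * mu * mu)%:E = \int[P]_w (2 * mu * S w)%:E.
    under eq_integral do rewrite EFinM.
    rewrite ge0_integralZl//; last 3 first.
    - exact/measurable_EFinP.
    - by move=> w _; rewrite lee_fin.
    - by rewrite lee_fin mulr_ge0.
    by rewrite ES -EFinM.
  have -> : (mu ^+ 2)%:E = \int[P]_w (mu ^+ 2)%:E.
    by rewrite integral_cst//= probability_setT mule1.
  have mSmu : measurable_fun setT (fun w => (S w - mu) ^+ 2)%R.
    by apply: measurable_funX; exact: measurable_funB.
  rewrite -!ge0_integralD//.
  - by apply: eq_integral => w _; rewrite -!EFinD; congr EFin; ring.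
  - by move=> w _; rewrite lee_fin sqr_ge0.
  - by apply/measurable_EFinP; exact: measurable_funX.
  - by move=> w _; rewrite lee_fin sqr_ge0.
  - by move=> w _; rewrite lee_fin sqr_ge0.
  - exact/measurable_EFinP.
  - by move=> w _; rewrite lee_fin !mulr_ge0.
  - by apply/measurable_EFinP; exact: measurable_funM.
rewrite -(@leeD2rE _ (2 * mu * mu)%:E)// [leLHS]key.
apply: (le_trans (leeD2r _ ES2)).
by rewrite -!EFinD lee_fin; rewrite le_eqVlt; apply/orP; left; apply/eqP; ring.
Qed.

Lemma integral_sqr_average (I : Type) (s : seq I) (Z : I -> Omega -> R)
    (r : R) : (0 <= r)%R ->
    (forall i, measurable_fun setT (Z i)) ->
    (forall i, \int[P]_w (Z i w ^+ 2)%:E <= r%:E) ->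
  \int[P]_w (((size s)%:R^-1 * \sum_(i <- s) Z i w) ^+ 2)%:E <= r%:E.
Proof.
move=> r0 mZ Zr.
have mZ2 i : measurable_fun setT (fun w => (Z i w ^+ 2)%:E).
  by apply/measurable_EFinP; exact: measurable_funX.
have Z20 i w : 0 <= (Z i w ^+ 2)%:E by rewrite lee_fin sqr_ge0.
apply: (@le_trans _ _ (\int[P]_w ((size s)%:R^-1 * \sum_(i <- s) Z i w ^+ 2)%:E)).
  apply: ge0_le_integral => //.
  - by move=> w _; rewrite lee_fin sqr_ge0.
  - apply/measurable_EFinP; apply: measurable_funX; apply: measurable_funM => //.
    exact: measurable_sum.
  - apply/measurable_EFinP; apply: measurable_funM => //.
    by apply: measurable_sum => i; exact: measurable_funX.
  move=> w _; rewrite lee_fin exprMn.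
  have [->|s0] := posnP (size s); first by rewrite invr0 expr0n !mul0r.
  rewrite expr2 -mulrA ler_wpM2l ?invr_ge0//.
  by rewrite ler_pdivrMl ?ltr0n// sqr_sum_le.
have E w : ((size s)%:R^-1 * \sum_(i <- s) Z i w ^+ 2)%:E =
    ((size s)%:R^-1)%:E * \sum_(i <- s) (Z i w ^+ 2)%:E.
  by rewrite EFinM sumEFin.
under eq_integral do rewrite E.
rewrite ge0_integralZl//; last 2 first.
- exact: emeasurable_sum.
- by move=> w _; exact: sume_ge0.
rewrite ge0_integral_sum//.
apply: (@le_trans _ _ (((size s)%:R^-1)%:E * \sum_(i <- s) r%:E)).
  by rewrite lee_wpmul2l ?lee_fin ?invr_ge0//; exact: lee_sum.
rewrite sumEFin -EFinM lee_fin big_const_seq count_predT iter_addr_0 -(mulr_natl r).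
have [->|s0] := posnP (size s); first by rewrite mul0r mulr0.
by rewrite mulKf// pnatr_eq0 -lt0n.
Qed.

Lemma Lnorm2E (Z : Omega -> R) :
  'N[P]_2%:E[EFin \o Z] = (\int[P]_w (Z w ^+ 2)%:E) `^ 2^-1.
Proof.
rewrite unlock; congr (_ `^ _); apply: eq_integral => w _ /=.
by rewrite powR_mulrn// real_normK// num_real.
Qed.

Lemma Lfun2_measurable (Z : Omega -> R) :
  Z \in Lfun P 2%:E -> measurable_fun setT Z.
Proof. by move=> /sub_Lfun_mfun; rewrite inE. Qed.

Lemma Lfun2_sqr_lty (Z : Omega -> R) : Z \in Lfun P 2%:E ->
  \int[P]_w (Z w ^+ 2)%:E < +oo.
Proof.
move/Lfun2_integrable_sqr/integrableP => [_]; apply: le_lt_trans.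
rewrite le_eqVlt; apply/orP; left; apply/eqP; apply: eq_integral => w _ /=.
by rewrite ger0_norm// sqr_ge0.
Qed.

Lemma Lfun2P (Z : Omega -> R) : measurable_fun setT Z ->
  \int[P]_w (Z w ^+ 2)%:E < +oo -> Z \in Lfun P 2%:E.
Proof.
move=> mZ Zoo; rewrite inE; apply/andP; split; rewrite inE//=.
by rewrite /finite_norm Lnorm2E poweR_lty.
Qed.

Lemma Lfun2_Lfun1 (Z : Omega -> R) : Z \in Lfun P 2%:E -> Z \in Lfun P 1.
Proof. by apply: Lfun_subset12; exact: fin_num_measure. Qed.

Lemma Lfun2_integral_fin_num (Z : Omega -> R) : Z \in Lfun P 2%:E ->
  \int[P]_w (Z w)%:E \is a fin_num.
Proof. by move/Lfun2_Lfun1/expectation_fin_num; rewrite unlock. Qed.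

Lemma sqr_integral_le (Z : Omega -> R) : Z \in Lfun P 2%:E ->
  (fine (\int[P]_w (Z w)%:E) ^+ 2)%:E <= \int[P]_w (Z w ^+ 2)%:E.
Proof.
move=> Z2; have := variance_ge0 P Z; rewrite varianceE// unlock.
have := Lfun2_integral_fin_num Z2.
case: (\int[P]_w (Z w)%:E) => // m _ /= var0.
by rewrite expr2 -sube_ge0//; exact: var0.
Qed.

Lemma ereal_cvg0P (x : nat -> \bar R) : (forall n, 0 <= x n) ->
  x n @[n --> \oo] --> 0 <->
  (forall eps : R, (0 < eps)%R -> exists n0, forall n, (n0 <= n)%N ->
     x n <= eps%:E).
Proof.
move=> x0; split=> [/fine_cvgP[xfin /cvgr0_norm_le x_cvg] eps eps0|xeps].
  have [n1 _ n1P] := xfin; have [n2 _ n2P] := x_cvg _ eps0.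
  exists (maxn n1 n2) => n; rewrite geq_max => /andP[/n1P /= xn /n2P /=].
  rewrite -(fineK xn) lee_fin; apply: le_trans; exact: ler_norm.
have [n1 n1P] := xeps 1%R ltr01.
have xfin n : (n1 <= n)%N -> x n \is a fin_num.
  by move=> /n1P x1; rewrite ge0_fin_numE// (le_lt_trans x1)// ltry.
apply/fine_cvgP; split; first by exists n1 => // n /= /xfin.
apply/cvgr0Pnorm_le => eps /xeps[n2 n2P].
exists (maxn n1 n2) => // n /=; rewrite geq_max => /andP[/xfin xn /n2P].
by rewrite -{1}(fineK xn) lee_fin ger0_norm// fine_ge0.
Qed.

(** Dominated convergence: the difference vanishes as soon as [n] exceeds
    [`|Z w|], and its square is at most [Z w ^+ 2]. *)
Lemma cutoff_cvg (Z : Omega -> R) (eps : R) : (0 < eps)%R ->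
    Z \in Lfun P 2%:E ->
  exists n0, forall n, (n0 <= n)%N ->
    \int[P]_w ((Z w - cutoff n%:R (Z w)) ^+ 2)%:E <= eps%:E.
Proof.
move=> eps0 Z2; have mZ := Lfun2_measurable Z2.
pose r (n : nat) w := ((Z w - cutoff n%:R (Z w)) ^+ 2)%R.
have r0 n w : 0 <= (r n w)%:E by rewrite lee_fin sqr_ge0.
have [|||||_ _ r_cvg] := @dominated_convergence _ Omega R P setT measurableT
   (fun n w => (r n w)%:E) (cst 0) (fun w => (Z w ^+ 2)%:E).
- move=> n; apply/measurable_EFinP; apply: measurable_funX.
  apply: measurable_funB => //.
  exact: (measurableT_comp (measurable_cutoff _) mZ).
- exact: measurable_cst.
- apply: aeW => w _; apply: cvg_near_cst.
  exists (Num.truncn `|Z w|).+1 => // n /= Zn.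
  have : (`|Z w| <= n%:R)%R.
    by apply: ltW; apply: lt_le_trans (truncnS_gt _) _; rewrite ler_nat.
  rewrite ler_norml /r /cutoff => /andP[nZ Zn'].
  by rewrite (min_idPr Zn') (max_idPr nZ) subrr expr0n.
- exact: Lfun2_integrable_sqr.
- by apply: aeW => w n _; rewrite gee0_abs// lee_fin sqr_sub_cutoff_le.
move: r_cvg; rewrite integral0 => /ereal_cvg0P; apply => //.
by move=> n; exact: integral_ge0.
Qed.

Lemma Lnorm2_cvg0 (Y : nat -> Omega -> R) :
    (forall eps : R, (0 < eps)%R -> exists n0, forall n, (n0 <= n)%N ->
       \int[P]_w (Y n w ^+ 2)%:E <= eps%:E) ->
  'N[P]_2%:E[EFin \o Y n] @[n --> \oo] --> 0.
Proof.
move=> Yeps; apply/ereal_cvg0P => [n|eps eps0]; first exact: Lnorm_ge0.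
have [n0 n0P] := Yeps (eps ^+ 2)%R (exprn_gt0 2 eps0).
exists n0 => n /n0P le_eps; rewrite Lnorm2E.
have -> : eps%:E = (eps ^+ 2)%:E `^ 2^-1.
  by rewrite poweR_EFin -powR_mulrn ?ltW// -powRrM mulfV// powRr1// ltW.
apply: gt0_ler_poweR => //.
- by rewrite in_itv/= leey integral_ge0// => w _; rewrite lee_fin sqr_ge0.
- by rewrite in_itv/= leey lee_fin sqr_ge0.
Qed.

End SecondMoments.

(** * Variance of sums of bounded blocks *)

Section LawOfLargeNumbers.
Context {R : realType} {d : measure_display} {T : measurableType d}.
Variables (Q : R.-pker T ~> T) (pi : probability T R).
Hypothesis Q_pi : invariant_proba Q pi.
Context {d' : measure_display} {Omega : measurableType d'}.
Variables (P : probability Omega R) (X : tree -> {RV P >-> T}).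
Hypothesis X_bmc : branching_markov_chain pi Q X.
Variable k : nat.
Local Open Scope ereal_scope.
Local Notation W := (powspace tree T).
Local Notation path := (path_of X).

(** The family [F] is indexed by words; for [u] of height at least [k] the
    index is the word below the [k]-th ancestor of [u], and [F] is evaluated
    on the process seen from this ancestor. *)
Definition block_value (F : tree -> (tree -> T) -> R) (u : tree)
    (x : tree -> T) : R :=
  F (drop (size u - k) u) (translate (take (size u - k) u) x).

Definition word_mean (F : tree -> (tree -> T) -> R) (w : tree) : R :=
  fine (\int[P]_o (F w (path o))%:E).

(** Both sides are the same integral under [pi], the right one with the root
    as base. *)
Lemma stationary_law (g : (tree -> T) -> \bar R) a : (forall z, 0 <= g z) ->
    measurable_fun [set: W] g -> depends_on (below k) g ->
  \int[P]_w g (translate a (path w)) = \int[P]_w g (path w).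
Proof.
move=> g0 mg gk; rewrite (integral_stationary Q_pi X_bmc a g0 mg gk).
by rewrite -(integral_stationary Q_pi X_bmc [::] g0 mg gk).
Qed.

Lemma measurable_block_value F u : (forall w, measurable_fun [set: W] (F w)) ->
  measurable_fun setT (fun w => block_value F u (path w)).
Proof.
move=> mF; rewrite /block_value.
have mt := measurable_translate (take (size u - k) u) (T := T).
exact: (measurableT_comp (mF _) (measurableT_comp mt (measurable_path_of X))).
Qed.

Section Bounded.
Variables (F : tree -> (tree -> T) -> R) (K : R).
Hypothesis mF : forall w, measurable_fun [set: W] (F w).
Hypothesis Fk : forall w, depends_on (below k) (F w).
Hypothesis F0 : forall w x, (0 <= F w x)%R.
Hypothesis FK : forall w x, (F w x <= K)%R.
Variables (D t : nat) (delta : R).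
Hypothesis delta0 : (0 <= delta)%R.
Hypothesis tv : forall n x, (t <= n)%N ->
  tv_dist (kpow Q n x) pi <= delta%:E.

Local Notation mean_at u := (word_mean F (drop (size u - k) u)).

Lemma measurable_word_path w : measurable_fun setT (fun o => F w (path o)).
Proof. exact: (measurableT_comp (mF w) (measurable_path_of X)). Qed.

Lemma integral_word_path_fin_num w :
  \int[P]_o (F w (path o))%:E \is a fin_num.
Proof.
rewrite ge0_fin_numE; last by apply: integral_ge0 => o _; rewrite lee_fin.
apply: le_lt_trans.
  exact: (bounded_integral_le (c := K) P (measurable_word_path w)).
exact: ltry.
Qed.

Lemma word_mean_ge0 w : (0 <= word_mean F w)%R.
Proof. by rewrite fine_ge0// integral_ge0// => o _; rewrite lee_fin. Qed.

Lemma integral_block_value u :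
  \int[P]_w (block_value F u (path w))%:E = (mean_at u)%:E.
Proof.
rewrite (@stationary_law (fun x => (F (drop (size u - k) u) x)%:E))//.
- by rewrite fineK// integral_word_path_fin_num.
- by move=> x; rewrite lee_fin.
- exact/measurable_EFinP.
- by move=> x y xy; congr EFin; exact: Fk.
Qed.

(** A bound for the indicator that [decorrelation] is not available for the
    pair, arranged as a sum so as to be counted easily. *)
Definition close_blocks (u v : tree) : R :=
  ((size u < D + t + k)%N%:R + (size v < D + t + k)%N%:R +
   (take D u == take D v)%:R)%R.

(** A distant pair has a common generation [D] with different ancestors, and
    at least [t] generations between [D] and the base of the first block. For
    the other pairs the trivial bound [K ^+ 2] is used. *)
Lemma block_covariance u v :
  \int[P]_w (block_value F u (path w) * block_value F v (path w))%:E <=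
  (mean_at u * mean_at v + K ^+ 2 * (delta + close_blocks u v))%:E.
Proof.
have K0 : (0 <= K)%R by exact: le_trans (F0 [::] (fun=> point)) (FK _ _).
have [far|near] := boolP [&& D + t + k <= size u, D + t + k <= size v &
                             take D u != take D v]%N; last first.
  apply: (@le_trans _ _ (K ^+ 2)%:E).
    apply: bounded_integral_le => [|w|w].
    - by apply: measurable_funM; exact: measurable_block_value.
    - by apply: mulr_ge0; exact: F0.
    - by rewrite expr2; apply: ler_pM; [exact: F0|exact: F0|exact: FK|exact: FK].
  rewrite lee_fin -[leLHS]add0r lerD ?mulr_ge0 ?word_mean_ge0//.
  rewrite -[leLHS]mulr1 ler_wpM2l ?sqr_ge0//.
  rewrite -[leLHS]add0r lerD// /close_blocks.
  move: near; rewrite !negb_and -!ltnNge negbK.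
  by case: (_ < _)%N => /=; case: (_ < _)%N => /=; case: eqP => //= _ _;
    rewrite ?addr0 ?add0r ?lerDl ?lerDr// -addrA lerDl.
case/and3P: far => Du Dv uv.
have cutE (x : tree) : (D + t + k <= size x)%N -> exists b,
    [/\ take (size x - k) x = take D x ++ b, (t <= size b)%N &
        size (take D x) = D].
  move=> Dx; exists (drop D (take (size x - k) x)); split.
  - rewrite -[in LHS](cat_take_drop D (take (size x - k) x)) take_takel//.
    by rewrite leq_subRL; lia.
  - by rewrite size_drop size_takel ?leq_subr//; lia.
  - by rewrite size_takel//; lia.
have [b1 [uE tb1 sD1]] := cutE u Du; have [b2 [vE _ sD2]] := cutE v Dv.
have mE (w : tree) : measurable_fun [set: W] (fun x => (F w x)%:E).
  exact/measurable_EFinP.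
have F0E w x : 0 <= (F w x)%:E by rewrite lee_fin.
have FkE w : depends_on (below k) (fun x => (F w x)%:E).
  by move=> x y xy; congr EFin; exact: Fk.
have FKE w x : (F w x)%:E <= K%:E by rewrite lee_fin.
have rootE w : \int[pi]_y root_int Q k (fun x => (F w x)%:E) y =
    \int[P]_o (F w (path o))%:E.
  by rewrite -(integral_stationary Q_pi X_bmc [::] (F0E w) (mE w) (FkE w)).
have := @decorrelation _ _ _ Q pi Q_pi _ _ P X X_bmc k
  (fun x => (F (drop (size u - k) u) x)%:E)
  (fun x => (F (drop (size v - k) v) x)%:E) K delta (take D u) (take D v) b1 b2
  (F0E _) (F0E _) (mE _) (mE _) (FkE _) (FkE _) (FKE _)
  (etrans sD1 (esym sD2)) uv (fun y => tv y tb1).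
rewrite !rootE -uE -vE => cov; apply: le_trans cov _.
rewrite -(fineK (integral_word_path_fin_num (drop (size u - k) u))).
rewrite -(fineK (integral_word_path_fin_num (drop (size v - k) v))).
rewrite -EFinD -EFinM lee_fin -/(mean_at u) -/(mean_at v) mulrDl lerD2l.
have mK : (mean_at v <= K)%R.
  rewrite -lee_fin /word_mean fineK ?integral_word_path_fin_num//.
  by apply: bounded_integral_le => //; exact: measurable_word_path.
apply: (@le_trans _ _ (K * delta * K)%R); first by rewrite ler_wpM2l ?mulr_ge0.
rewrite mulrAC -expr2 ler_wpM2l ?sqr_ge0// lerDl /close_blocks.
by rewrite !addr_ge0.
Qed.

Lemma variance_bound z : (D <= size z)%N ->
  \int[P]_w ((\sum_(u <- Delta_full z `\` Tlt k) block_value F u (path w) -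
              \sum_(u <- Delta_full z `\` Tlt k) mean_at u) ^+ 2)%:E
  <= (K ^+ 2 * (#|` Delta_full z `\` Tlt k|%:R ^+ 2 * delta +
       #|` Delta_full z `\` Tlt k|%:R *
         (2 ^ (D + t + k).+1 + 2 ^ ((size z).+1 - D))%:R))%:E.
Proof.
move=> Dz; set A := Delta_full z `\` Tlt k; set N : R := #|` A|%:R.
apply: le_trans.
  apply: (@integral_sqr_sum_centered _ _ _ P _ A
    (fun u w => block_value F u (path w)) (fun u => mean_at u)
    (fun u v => K ^+ 2 * (delta + close_blocks u v))%R).
  - by move=> u; exact: measurable_block_value.
  - by move=> u w; exact: F0.
  - exact: integral_block_value.
  - exact: block_covariance.
rewrite lee_fin.
under eq_bigr do rewrite -mulr_sumr.
rewrite -mulr_sumr ler_wpM2l ?sqr_ge0//.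
under eq_bigr do rewrite big_split/= big_const_seq count_predT iter_addr_0.
rewrite big_split/= big_const_seq count_predT iter_addr_0 lerD//.
  by rewrite -mulrnA -(mulr_natl delta) natrM -expr2.
pose low (u : tree) := (size u < D + t + k)%N.
have inner u : (\sum_(v <- A) close_blocks u v = N * (low u)%:R +
    (count low A)%:R + (count (fun v => take D v == take D u) A)%:R)%R.
  rewrite /close_blocks !big_split/= big_const_seq count_predT iter_addr_0.
  rewrite !sum_nat_of_bool -(mulr_natl (low u)%:R); congr (_ + _%:R)%R.
  by apply: eq_count => v; rewrite eq_sym.
have low_le : ((count low A)%:R <= (2 ^ (D + t + k))%:R :> R)%R.
  by rewrite ler_nat count_low.
apply: (@le_trans _ _ (\sum_(u <- A) (N * (low u)%:R +
    (2 ^ (D + t + k) + 2 ^ ((size z).+1 - D))%:R)))%R.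
  apply: ler_sum => u _; rewrite inner natrD addrA lerD//.
    by rewrite lerD2l.
  by rewrite ler_nat count_same_ancestor.
rewrite big_split/= -mulr_sumr sum_nat_of_bool big_const_seq count_predT.
rewrite iter_addr_0 -(mulr_natl (2 ^ _ + _)%:R) -mulrDr ler_wpM2l//.
by rewrite natrD addrA -natrD expnS mul2n -addnn !natrD -!addrA lerD2r//.
Qed.

End Bounded.
End LawOfLargeNumbers.

(** * Convergence of block averages in mean square *)

Section Convergence.
Context {R : realType} {d : measure_display} {T : measurableType d}.
Variables (Q : R.-pker T ~> T) (pi : probability T R).
Hypothesis Q_ergodic : unif_geom_ergodic Q pi.
Hypothesis Q_pi : invariant_proba Q pi.
Context {d' : measure_display} {Omega : measurableType d'}.
Variables (P : probability Omega R) (X : tree -> {RV P >-> T}).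
Hypothesis X_bmc : branching_markov_chain pi Q X.
Variable k : nat.
Local Open Scope ereal_scope.
Local Notation W := (powspace tree T).
Local Notation path := (path_of X).

(** The constant of geometric ergodicity is nonnegative since it bounds a
    total variation distance. *)
Lemma ergodic_tv (eta : R) : (0 < eta)%R -> exists t (delta : R),
  [/\ (0 <= delta)%R, (delta <= eta)%R & forall n x, (t <= n)%N ->
    tv_dist (kpow Q n x) pi <= delta%:E].
Proof.
move=> eta0; have [rho [C [rho0 rho1 tv]]] := Q_ergodic.
have C0 : (0 <= C)%R.
  rewrite -lee_fin -[C]mulr1 -(expr0 rho).
  apply: le_trans (tv point 0%N).
  apply: (@le_trans _ _ `|kpow Q 0 point set0 - pi set0|); first exact: abse_ge0.
  by rewrite /tv_dist; apply: ereal_sup_ubound; exists set0.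
have := @cvg_expr _ rho; rewrite ger0_norm ?ltW// => /(_ rho1)/cvgr0Pnorm_le.
have C1 : (0 < C + 1)%R by rewrite ltr_wpDl.
move=> /(_ (eta / (C + 1))%R (divr_gt0 eta0 C1))[t _ /(_ t (leqnn t))].
rewrite /= ger0_norm; last by rewrite exprn_ge0// ltW.
move=> rho_t.
exists t, (C * rho ^+ t)%R; split.
- by rewrite mulr_ge0// exprn_ge0// ltW.
- apply: (@le_trans _ _ ((C + 1) * rho ^+ t))%R.
    by rewrite ler_wpM2r ?exprn_ge0 ?lerDl// ltW.
  by rewrite mulrC -ler_pdivlMr.
- move=> n x tn; apply: le_trans (tv x n) _.
  by rewrite lee_fin ler_wpM2l// ler_wiXn2l// ltW.
Qed.

Variable F : tree -> (tree -> T) -> R.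
Hypothesis mF : forall w, measurable_fun [set: W] (F w).
Hypothesis Fk : forall w, depends_on (below k) (F w).
Hypothesis F_words : forall w x, size w != k -> F w x = 0%R.
Hypothesis F_L2 : forall w, (fun o => F w (path o)) \in Lfun P 2%:E.

Definition excess c w x : R := (F w x - cutoff c (F w x))%R.

(** The shift by [c] makes the function nonnegative, as [variance_bound]
    requires, without changing its fluctuations. *)
Definition bounded_part c w x : R := (cutoff c (F w x) + c)%R.

Lemma measurable_excess c w : measurable_fun [set: W] (excess c w).
Proof.
by apply: measurable_funB => //; exact: (measurableT_comp (measurable_cutoff c)).
Qed.

Lemma measurable_bounded_part c w : measurable_fun [set: W] (bounded_part c w).
Proof.
by apply: measurable_funD => //; exact: (measurableT_comp (measurable_cutoff c)).
Qed.

Lemma bounded_part_ge0 c w x : (0 <= bounded_part c w x)%R.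
Proof. by rewrite -lerBlDr sub0r le_max lexx. Qed.

Lemma bounded_part_le c w x : (0 <= c)%R -> (bounded_part c w x <= 2 * c)%R.
Proof.
move=> c0; rewrite mulr_natl mulr2n lerD2r ge_max ge_min lexx/= andbT.
by rewrite (le_trans _ c0)// oppr_le0.
Qed.

(** One cutoff serves all words since there are finitely many of them; by
    stationarity it then serves all vertices, see [integral_sqr_block]. *)
Lemma excess_small (eps : R) : (0 < eps)%R -> exists2 c : R, (0 <= c)%R &
  forall w, \int[P]_o (excess c w (path o) ^+ 2)%:E <= eps%:E.
Proof.
move=> eps0.
have [n0 n0P] : exists n0 : nat, forall n, (n0 <= n)%N ->
    {in words k, forall w, \int[P]_o (excess n%:R w (path o) ^+ 2)%:E <= eps%:E}.
  elim: (words k) => [|w s [n1 n1P]]; first by exists 0%N.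
  have [n2 n2P] := cutoff_cvg eps0 (F_L2 w).
  exists (maxn n1 n2) => n; rewrite geq_max => /andP[/n1P ns /n2P nw] v.
  by rewrite inE => /orP[/eqP ->//|]; exact: ns.
exists n0%:R => // w; have [wk|wk] := eqVneq (size w) k.
  by apply: (n0P n0 (leqnn _)); rewrite in_words wk.
under eq_integral do rewrite /excess /cutoff F_words// sub0r sqrrN.
rewrite (_ : Num.max _ _ = 0)%R ?expr0n ?integral0 ?lee_fin ?ltW//.
by rewrite min_r// max_r// oppr_le0.
Qed.

Lemma word_mean_split c w : (0 <= c)%R ->
    \int[P]_o (excess c w (path o) ^+ 2)%:E < +oo ->
  (word_mean X F w =
   word_mean X (excess c) w + word_mean X (bounded_part c) w - c)%R.
Proof.
move=> c0 exc_lty.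
have mpath := measurable_path_of X.
have ex2 : (fun o => excess c w (path o)) \in Lfun P 2%:E.
  by apply: Lfun2P => //; exact: (measurableT_comp (measurable_excess c w) mpath).
have mb : measurable_fun setT (fun o => bounded_part c w (path o)).
  exact: (measurableT_comp (measurable_bounded_part c w) mpath).
have bd2 : (fun o => bounded_part c w (path o)) \in Lfun P 2%:E.
  apply: Lfun2P => //.
  apply: (le_lt_trans (bounded_integral_le (c := ((2 * c) ^+ 2)%R) P _ _ _)).
  - exact: measurable_funX.
  - by move=> o; exact: sqr_ge0.
  - move=> o; rewrite ler_pXn2r ?nnegrE ?bounded_part_ge0 ?bounded_part_le//.
    by rewrite mulr_ge0.
  - exact: ltry.
have FE : (fun o => (F w (path o))%:E) =
    (fun o => (excess c w (path o) + (bounded_part c w (path o) - c))%:E).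
  apply/funext => o; congr EFin; rewrite /excess /bounded_part; ring.
have i_ex := (Lfun1_integrable _ _).1 (Lfun2_Lfun1 ex2).
have i_bd := (Lfun1_integrable _ _).1 (Lfun2_Lfun1 bd2).
have i_c : P.-integrable setT (EFin \o cst c).
  by apply/Lfun1_integrable; exact: Lfun_cst.
have E : \int[P]_o (F w (path o))%:E = \int[P]_o (excess c w (path o))%:E +
    (\int[P]_o (bounded_part c w (path o))%:E - c%:E).
  have -> : c%:E = \int[P]_o c%:E.
    by rewrite integral_cst//= probability_setT mule1.
  rewrite FE -integralB// -integralD//.
  exact: integrableB.
have f_ex := Lfun2_integral_fin_num ex2.
have f_bd := Lfun2_integral_fin_num bd2.
have f_c : c%:E \is a fin_num by [].
have f_bdc : \int[P]_o (bounded_part c w (path o))%:E - c%:E \is a fin_num.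
  by rewrite (fin_numB _ c%:E) f_bd.
by rewrite /word_mean E (fineD f_ex f_bdc) (fineB f_bd f_c) addrA.
Qed.

Lemma integral_sqr_block (G : tree -> (tree -> T) -> R) (r : R) (u : tree) :
    (forall w, measurable_fun [set: W] (G w)) ->
    (forall w, depends_on (below k) (G w)) ->
    (forall w, \int[P]_o (G w (path o) ^+ 2)%:E <= r%:E) ->
  \int[P]_o (block_value k G u (path o) ^+ 2)%:E <= r%:E.
Proof.
move=> mG Gk Gr.
have := stationary_law Q_pi X_bmc (k := k)
  (g := fun x => (G (drop (size u - k) u) x ^+ 2)%:E) (take (size u - k) u).
move=> ->; first exact: Gr.
- by move=> x; rewrite lee_fin sqr_ge0.
- by apply/measurable_EFinP; exact: measurable_funX.
- by move=> x y xy; congr (_ ^+ 2)%:E; exact: Gk.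
Qed.

(** The error splits into the average of the excesses, the centered average of
    the bounded parts, the average of the means of the excesses, and the error
    on the frequencies of words. With the factor [4] from [sqr_sum4_le], each
    square has to be at most [eps / 16]. *)
Lemma block_average_cvg (eps : R) : (0 < eps)%R ->
  exists l0, forall z : tree, (l0 <= size z)%N ->
  \int[P]_o (((#|` Delta_full z `\` Tlt k|%:R)^-1 *
      (\sum_(u <- Delta_full z `\` Tlt k) block_value k F u (path o)) -
      (2 ^ k)%:R^-1 * \sum_(w <- words k) word_mean X F w) ^+ 2)%:E <= eps%:E.
Proof.
move=> eps0; pose eps1 := (eps / 16)%R.
have eps10 : (0 < eps1)%R by rewrite divr_gt0.
have [c c0 exc] := excess_small eps10.
have exc_lty w : \int[P]_o (excess c w (path o) ^+ 2)%:E < +oo.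
  exact: le_lt_trans (exc w) (ltry _).
pose kap := ((2 * c) ^+ 2)%R.
(* [eta] is the share of each of the three terms of [variance_bound],
   divided by the size of the ball squared, in [eps1] *)
pose eta := (eps1 / (3 * (kap + 1)))%R.
have kap0 : (0 <= kap)%R by exact: sqr_ge0.
have eta0 : (0 < eta)%R by rewrite divr_gt0// mulr_gt0// ltr_wpDl.
have [t [delta [delta0 delta_le tv]]] := ergodic_tv eta0.
have [D D_le] := le_divr_pow2 4 eta0.
have [l1 l1P] := le_divr_pow2 (2 * (2 ^ (D + t + k).+1)%:R) eta0.
(* a number at most [zeta] has a square at most [eps1] *)
pose zeta := Num.min 1%R eps1.
have zeta0 : (0 < zeta)%R by rewrite lt_min ltr01.
have [l2 l2P] :=
  le_divr_pow2 (2 * (2 * \sum_(w <- words k) `|word_mean X F w|)) zeta0.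
exists (maxn (maxn l1 l2) (maxn D k.+1)) => z.
rewrite !geq_max => /andP[/andP[l1z l2z] /andP[Dz kz]].
set A := Delta_full z `\` Tlt k; set N : R := #|` A|%:R.
have pow0 n : (0 < (2 ^ n)%:R :> R)%R by rewrite ltr0n expn_gt0.
have NE : ((2 ^ size z)%:R / 2 <= N)%R.
  have -> : (2 ^ size z = 2 * 2 ^ (size z).-1)%N.
    by rewrite -expnS prednK// (leq_trans _ kz).
  by rewrite natrM mulrAC divff// mul1r ler_nat card_ball_ge.
have N0 : (0 < N)%R by apply: lt_le_trans NE; rewrite divr_gt0.
(* division by the size of the ball, bounded below by half of
   [2 ^ size z] *)
have divN (x : R) : (0 <= x)%R -> (x / N <= 2 * x / (2 ^ size z)%:R)%R.
  move=> x0; rewrite ler_pdivrMr// mulrAC.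
  rewrite [leRHS](_ : _ = x * (N / ((2 ^ size z)%:R / 2)))%R; last first.
    by field; rewrite gt_eqF.
  by rewrite ler_peMr// ler_pdivlMr ?divr_gt0// mul1r.
pose wd (u : tree) := drop (size u - k) u.
pose a o := (N^-1 * \sum_(u <- A) block_value k (excess c) u (path o))%R.
pose b o := (N^-1 * (\sum_(u <- A) block_value k (bounded_part c) u (path o) -
                     \sum_(u <- A) word_mean X (bounded_part c) (wd u)))%R.
pose c' (o : Omega) := (N^-1 * \sum_(u <- A) - word_mean X (excess c) (wd u))%R.
pose e := (N^-1 * \sum_(u <- A) word_mean X F (wd u) -
           (2 ^ k)%:R^-1 * \sum_(w <- words k) word_mean X F w)%R.
have split_error o : (N^-1 * (\sum_(u <- A) block_value k F u (path o)) -
    (2 ^ k)%:R^-1 * \sum_(w <- words k) word_mean X F w = a o + b o + c' o + e)%R.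
  rewrite /a /b /c' /e addrA -!mulrDr -!sumrN -!big_split/=; congr (_ * _ - _)%R.
  apply: eq_bigr => u _; rewrite (@word_mean_split c (wd u))// /block_value.
  by rewrite /excess /bounded_part; ring.
have mex w : measurable_fun [set: W] (excess c w) by exact: measurable_excess.
have mbd w : measurable_fun [set: W] (bounded_part c w).
  exact: measurable_bounded_part.
have exk w : depends_on (below k) (excess c w).
  by move=> x y xy; rewrite /excess; have -> : F w x = F w y by exact: Fk.
have bdk w : depends_on (below k) (bounded_part c w).
  by move=> x y xy; rewrite /bounded_part; have -> : F w x = F w y by exact: Fk.
have ma : measurable_fun setT a.
  apply: measurable_funM => //; apply: measurable_sum => u.
  exact: measurable_block_value.
have mb : measurable_fun setT b.
  apply: measurable_funM => //; apply: measurable_funB => //.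
  by apply: measurable_sum => u; exact: measurable_block_value.
have mc' : measurable_fun setT c' by exact: measurable_cst.
have Ea : \int[P]_o (a o ^+ 2)%:E <= eps1%:E.
  apply: integral_sqr_average; first exact: ltW.
  - by move=> u; exact: measurable_block_value.
  - by move=> u; exact: integral_sqr_block.
have Ec : \int[P]_o (c' o ^+ 2)%:E <= eps1%:E.
  apply: (@integral_sqr_average _ _ _ P _ A
    (fun u _ => - word_mean X (excess c) (wd u))%R eps1).
  - exact: ltW.
  - by move=> u; exact: measurable_cst.
  - move=> u; rewrite integral_cst//= probability_setT mule1 sqrrN.
    apply: le_trans (exc (wd u)); apply: sqr_integral_le; apply: Lfun2P => //.
    exact: (measurableT_comp (mex (wd u)) (measurable_path_of X)).
have Ee : (e ^+ 2 <= eps1)%R.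
  have e_le : (`|e| <= zeta)%R.
    apply: le_trans (l2P _ l2z).
    have eE : (e = (\sum_(u <- A) word_mean X F (wd u) -
        N * ((2 ^ k)%:R^-1 * \sum_(w <- words k) word_mean X F w)) / N)%R.
      by rewrite /e; field; rewrite gt_eqF//= gt_eqF.
    rewrite eE normrM normfV (gtr0_norm N0).
    apply: le_trans (divN _ _); last by rewrite mulr_ge0// sumr_ge0.
    by rewrite ler_pM2r ?invr_gt0//; apply: word_frequency; exact: ltnW.
  rewrite -real_normK ?num_real// expr2.
  have /andP[z1 z2] : (zeta <= 1)%R && (zeta <= eps1)%R by rewrite -le_min lexx.
  apply: (@le_trans _ _ (1 * zeta)%R); last by rewrite mul1r.
  by apply: ler_pM => //; exact: le_trans e_le z1.
have Eb : \int[P]_o (b o ^+ 2)%:E <= eps1%:E.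
  have [x0 y0] : (0 <= (2 ^ (D + t + k).+1)%:R :> R)%R /\
    (0 <= (2 ^ ((size z).+1 - D))%:R :> R)%R by [].
  have vb := variance_bound Q_pi X_bmc mbd bdk (bounded_part_ge0 c)
    (fun w x => bounded_part_le w x c0) delta0 tv Dz.
  pose S o := (\sum_(u <- A) block_value k (bounded_part c) u (path o) -
               \sum_(u <- A) word_mean X (bounded_part c) (wd u))%R.
  have mS : measurable_fun setT S.
    apply: measurable_funB => //.
    by apply: measurable_sum => u; exact: measurable_block_value.
  have bE o : (b o ^+ 2)%:E = (N^-1 ^+ 2)%:E * (S o ^+ 2)%:E.
    by rewrite -EFinM -exprMn.
  under eq_integral do rewrite bE.
  rewrite ge0_integralZl//; last 3 first.
  - by apply/measurable_EFinP; exact: measurable_funX.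
  - by move=> o _; rewrite lee_fin sqr_ge0.
  - by rewrite lee_fin sqr_ge0.
  apply: (le_trans (lee_wpmul2l _ vb)); first by rewrite lee_fin sqr_ge0.
  rewrite -EFinM lee_fin -/A -/N -/kap.
  set p : R := (2 ^ (D + t + k).+1)%:R; set q : R := (2 ^ ((size z).+1 - D))%:R.
  rewrite natrD -/p -/q.
  have -> : (N^-1 ^+ 2 * (kap * (N ^+ 2 * delta + N * (p + q))) =
            kap * (delta + (p / N + q / N)))%R by field; rewrite gt_eqF.
  have p_le : (p / N <= eta)%R by apply: le_trans (divN _ x0) (l1P _ l1z).
  have q_le : (q / N <= eta)%R.
    apply: le_trans (divN _ y0) _; rewrite /q.
    apply: le_trans (D_le _ (leqnn D)); rewrite ler_pdivrMr// mulrAC ler_pdivlMr//.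
    rewrite -!natrM ler_nat -expnS -[4%N]/(2 ^ 2)%N -!expnD leq_exp2l//.
    by rewrite addSn subnK// leqW.
  apply: (@le_trans _ _ (kap * (eta + (eta + eta)))%R).
    by rewrite ler_wpM2l// lerD// lerD.
  have -> : (kap * (eta + (eta + eta)) = eps1 * (kap / (kap + 1)))%R.
    by rewrite /eta; field; rewrite gt_eqF// ltr_wpDl.
  rewrite ler_piMr ?(ltW eps10)// ler_pdivrMr ?ltr_wpDl// mul1r.
  by rewrite lerDl.
under eq_integral do rewrite split_error.
have m2 (g : Omega -> R) : measurable_fun setT g ->
    measurable_fun setT (fun o => (g o ^+ 2)%:E).
  by move=> mg; apply/measurable_EFinP; exact: measurable_funX.
have ge02 (g : Omega -> R) o : 0 <= (g o ^+ 2)%:E by rewrite lee_fin sqr_ge0.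
have integralD4 (f1 f2 f3 f4 : Omega -> \bar R) :
    (forall o, 0 <= f1 o) -> (forall o, 0 <= f2 o) -> (forall o, 0 <= f3 o) ->
    (forall o, 0 <= f4 o) -> measurable_fun setT f1 -> measurable_fun setT f2 ->
    measurable_fun setT f3 -> measurable_fun setT f4 ->
    \int[P]_o (f1 o + f2 o + f3 o + f4 o) =
    \int[P]_o f1 o + \int[P]_o f2 o + \int[P]_o f3 o + \int[P]_o f4 o.
  move=> f10 f20 f30 f40 mf1 mf2 mf3 mf4.
  have m12 := emeasurable_funD mf1 mf2.
  have p12 o : 0 <= f1 o + f2 o by exact: adde_ge0.
  have p123 o : 0 <= f1 o + f2 o + f3 o by exact: adde_ge0.
  have m123 := emeasurable_funD m12 mf3.
  by rewrite ge0_integralD// ge0_integralD// ge0_integralD.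
have me2 : measurable_fun setT (fun _ : Omega => (e ^+ 2)%:E) by [].
have p4 o : 0 <= (a o ^+ 2)%:E + (b o ^+ 2)%:E + (c' o ^+ 2)%:E + (e ^+ 2)%:E.
  by rewrite !adde_ge0// lee_fin sqr_ge0.
have m4 : measurable_fun setT (fun o => (a o ^+ 2)%:E + (b o ^+ 2)%:E +
    (c' o ^+ 2)%:E + (e ^+ 2)%:E).
  apply: emeasurable_funD => //; apply: emeasurable_funD; last exact: m2.
  by apply: emeasurable_funD; exact: m2.
apply: (@le_trans _ _ (4%:E * (\int[P]_o (a o ^+ 2)%:E + \int[P]_o (b o ^+ 2)%:E +
    \int[P]_o (c' o ^+ 2)%:E + \int[P]_o (e ^+ 2)%:E))).
  rewrite -integralD4//; [|by move=> o; rewrite lee_fin sqr_ge0|exact: m2..].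
  rewrite -ge0_integralZl//.
  apply: ge0_le_integral => //.
  - by move=> o _; rewrite lee_fin sqr_ge0.
  - apply: (m2 (fun o => a o + b o + c' o + e)%R).
    apply: measurable_funD => //; apply: measurable_funD => //.
    exact: measurable_funD.
  - exact: measurable_funeM.
  - by move=> o _; rewrite -!EFinD -EFinM lee_fin sqr_sum4_le.
apply: (@le_trans _ _ (4%:E * (eps1%:E + eps1%:E + eps1%:E + eps1%:E))).
  rewrite lee_wpmul2l//; apply: leeD; first by apply: leeD => //; apply: leeD.
  by rewrite integral_cst//= probability_setT mule1.
by rewrite -!EFinD -EFinM lee_fin /eps1 le_eqVlt; apply/orP; left; apply/eqP; field.
Qed.

End Convergence.

(** * The limit and the theorem *)

Section ProductExpectation.
Context {R : realType} {d1 d2 : measure_display} {Omega1 : measurableType d1}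
  {Omega2 : measurableType d2}.
Variables (P1 : probability Omega1 R) (P2 : probability Omega2 R).
Local Open Scope ereal_scope.

(** This is where independence of the random word and the chain enters: one
    event of the first factor times one variable of the second. *)
Lemma integral_prod_indic (B : set Omega1) (Z : Omega2 -> R) : measurable B ->
    P2.-integrable setT (EFin \o Z) ->
  (P1 \x P2).-integrable setT (fun z => (\1_B z.1 * Z z.2)%:E) /\
  \int[P1 \x P2]_z (\1_B z.1 * Z z.2)%:E = P1 B * \int[P2]_y (Z y)%:E.
Proof.
move=> mB iZ.
have mZ : measurable_fun setT Z by apply/measurable_EFinP; exact: measurable_int iZ.
have m1B : measurable_fun setT (\1_B : Omega1 -> R) by exact: measurable_indic.
have iB : P1.-integrable setT (EFin \o (\1_B : Omega1 -> R)).
  by apply: integrable_indic.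
have mh : measurable_fun setT (fun z : Omega1 * Omega2 => (\1_B z.1 * Z z.2)%:E).
  apply/measurable_EFinP; apply: measurable_funM.
    exact: (measurableT_comp m1B measurable_fst).
  exact: (measurableT_comp mZ measurable_snd).
have ih : (P1 \x P2).-integrable setT (fun z => (\1_B z.1 * Z z.2)%:E).
  apply/integrable12ltyP => //=.
  have /integrableP[_ absZ] := iZ.
  have inner x : \int[P2]_y `|(\1_B x * Z y)%:E| =
      (\1_B x)%:E * \int[P2]_y `|(Z y)%:E|.
    rewrite -ge0_integralZl//; last first.
      by apply: measurableT_comp => //; exact/measurable_EFinP.
    by apply: eq_integral => y _; rewrite EFinM abseM gee0_abs ?lee_fin.
  under eq_integral do rewrite inner.
  rewrite ge0_integralZr//; last 2 first.
  - exact/measurable_EFinP.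
  - exact: integral_ge0.
  rewrite integral_indic// setIT; apply: lte_mul_pinfty => //.
  exact: fin_num_measure.
split => //; rewrite -integral12_prod_meas1//= /fubini_F/=.
under eq_integral do under eq_integral do rewrite EFinM.
under eq_integral do rewrite integralZl//.
have : \int[P2]_y (Z y)%:E \is a fin_num by exact: integrable_fin_num.
case: (\int[P2]_y (Z y)%:E) => // m _.
under eq_integral do rewrite muleC.
by rewrite integralZl// integral_indic// setIT muleC.
Qed.

End ProductExpectation.

Section Shapes.
Context {R : realType} {d : measure_display} {T : measurableType d}.
Variables (k : nat) (f : forall S : {fset tree}, (S -> T) -> R).
Hypothesis f_measurable : forall S, S \in shapes k ->
  measurable_fun [set: powspace S T] (@f S).

(** Functions indexed by shapes become functions of whole configurations
    indexed by all words; the value zero outside length [k] makes the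
    measurability and square integrability hypotheses uniform in the word. *)
Definition word_value (w : tree) (x : tree -> T) : R :=
  if size w == k then @f (Delta_full w) (fun u : Delta_full w => x (val u))
  else 0.

Lemma Delta_full_shapes w : size w = k -> Delta_full w \in shapes k.
Proof. by move=> wk; apply/imfsetP; exists w => //=; rewrite in_Gen wk. Qed.

Lemma measurable_word_value w :
  measurable_fun [set: powspace tree T] (word_value w).
Proof.
rewrite /word_value; have [wk|_] := eqVneq; last exact: measurable_cst.
apply: (measurableT_comp (f_measurable (Delta_full_shapes wk))).
by apply: measurable_powspace => u; exact: measurable_coord.
Qed.

Lemma depends_on_word_value w :
  depends_on (below k) (word_value w).
Proof.
move=> x y xy; rewrite /word_value; case: eqP => // wk; congr (@f (Delta_full w)).
apply/funext => u; apply: xy => /=; rewrite -wk.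
have := valP u; rewrite in_Delta_full => /orP[/eqP ->//|].
exact: bfs_lt_size.
Qed.

Lemma shape_evalE u (x : tree -> T) : (k <= size u)%N ->
  shape_eval k (@f) u x = block_value k word_value u x.
Proof.
move=> ku; rewrite /block_value /word_value size_drop subKn// eqxx.
by rewrite /shape_eval /shape ancE.
Qed.

End Shapes.

Theorem theoremA2 (R : realType) (M : pmetricType R) (k : nat)
    (v : nat -> tree) (v_enum : bfs_enumeration v)
    (Q : R.-pker (borel M) ~> (borel M)) (pi : probability (borel M) R)
    (Q_ergodic : unif_geom_ergodic Q pi)
    (pi_unique : unique_invariant_proba Q pi)
    (d : measure_display) (Omega : measurableType d) (P : probability Omega R)
    (X : tree -> {RV P >-> borel M}) (X_bmc : branching_markov_chain pi Q X)
    (f : forall S : {fset tree}, (S -> M) -> R)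
    (f_borel : forall S, S \in shapes k ->
       measurable_fun [set: powspace S (borel M)] (f S))
    (f_L2 : forall S, S \in shapes k ->
       (fun w => f S (fun u : S => X (val u) w)) \in Lfun P 2%:E)
    (d' : measure_display) (Omega' : measurableType d')
    (P' : probability Omega' R) (U : Omega' -> tree)
    (U_unif : uniform_on_Gen P' k U) :
  let A (n : nat) := Delta_full (v n) `\` Tlt k in
  cvg_L2 P
    (fun n w => Mbar k (A n) f (fun u => X u w))
    (cst (fine ('E_(P' \x P)[(fun z =>
       shape_eval k f (U z.1) (fun u => X u z.2))])%E)).
Proof.
move=> A.
have [Q_pi _] := pi_unique.
pose F := @word_value R _ (borel M) k f.
pose path := path_of X.
have mF w : measurable_fun [set: powspace tree (borel M)] (F w).
  exact: measurable_word_value.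
have Fk w : depends_on (below k) (F w).
  exact: depends_on_word_value.
have F0 w x : size w != k -> F w x = 0 by rewrite /F /word_value => /negPf ->.
have FL2 w : (fun o => F w (path o)) \in Lfun P 2%:E.
  have [wk|wk] := eqVneq (size w) k.
    have -> : (fun o => F w (path o)) =
        (fun o => f (Delta_full w) (fun u : Delta_full w => X (val u) o)).
      by apply/funext => o; rewrite /F /word_value wk eqxx.
    exact/f_L2/Delta_full_shapes.
  have -> : (fun o => F w (path o)) = cst 0.
    by apply/funext => o; exact: F0.
  exact: Lfun_cst.
have MbarE n o : Mbar k (A n) f (fun u => X u o) =
    (#|` A n|%:R)^-1 * \sum_(u <- A n) block_value k F u (path o).
  rewrite /Mbar; congr (_ * _); apply: eq_big_seq => u.
  by rewrite mem_ball => /andP[ku _]; rewrite (@shape_evalE R _ (borel M)).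
have word_L2 w : P.-integrable setT (EFin \o (fun o => F w (path o))).
  by apply/Lfun1_integrable; exact: Lfun2_Lfun1.
set c := fine _.
have cE : c = (2 ^ k)%:R^-1 * \sum_(w <- words k) word_mean X F w.
  have [U_Gen U_law] := U_unif.
  pose h (w : tree) (z : Omega' * Omega) : \bar R :=
    (\1_(U @^-1` [set w]) z.1 * F w (path z.2))%:E.
  (* on the event that the random word is [w], only the term [h w] is nonzero *)
  have evalE z : (shape_eval k f (U z.1) (fun u => X u z.2))%:E =
      (\sum_(w <- words k) h w z)%E.
    have Uk : size (U z.1) = k by apply/eqP; rewrite -in_Gen.
    have Uw : U z.1 \in words k by rewrite in_words Uk.
    rewrite (bigD1_seq (U z.1)) ?uniq_words//= big1 ?adde0 => [|w wU]; last first.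
      rewrite /h indicE memNset ?mul0r// => Uz.
      by rewrite -Uz eqxx in wU.
    rewrite /h indicE mem_set// mul1r (@shape_evalE R _ (borel M)) ?Uk//.
    by rewrite /block_value Uk subnn drop0 take0.
  have cardG : #|` Gen k| = (2 ^ k)%N.
    rewrite -size_words; apply/perm_size/uniq_perm; rewrite ?fset_uniq ?uniq_words//.
    by move=> u; rewrite in_Gen in_words.
  have mU w : measurable (U @^-1` [set w]).
    have [/eqP wk|wk] := eqVneq (size w) k.
      by rewrite -in_Gen in wk; case: (U_law w wk).
    rewrite (_ : _ @^-1` _ = set0)//; apply/seteqP; split => // o /= Uo.
    by have := U_Gen o; rewrite in_Gen Uo (negPf wk).
  have ih w := (integral_prod_indic P' (mU w) (word_L2 w)).1.
  have hE w : w \in words k ->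
      (\int[P' \x P]_z h w z = ((2 ^ k)%:R^-1 * word_mean X F w)%:E)%E.
    rewrite in_words -in_Gen => /U_law[_ PU].
    rewrite (integral_prod_indic P' (mU w) (word_L2 w)).2 PU cardG EFinM.
    rewrite /word_mean fineK//.
    exact: (integrable_fin_num measurableT (word_L2 w)).
  rewrite /c unlock; under eq_integral do rewrite evalE.
  rewrite integral_sum// (eq_big_seq _ hE) sumEFin /=.
  by rewrite mulr_sumr.
have mblock u : measurable_fun setT (fun o => block_value k F u (path o)).
  exact: measurable_block_value.
split.
- move=> n; apply: Lfun2P.
    under eq_fun do rewrite MbarE.
    by apply: measurable_funM => //; exact: measurable_sum.
  under eq_integral do rewrite MbarE.
  have [r r0 rP] : exists2 r : R, 0 <= r & forall w,
      (\int[P]_o (F w (path o) ^+ 2)%:E <= r%:E)%E.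
    have sqr_ge0' v' : (0 <= \int[P]_o (F v' (path o) ^+ 2)%:E)%E.
      by apply: integral_ge0 => o _; rewrite lee_fin sqr_ge0.
    exists (\sum_(v <- words k) fine (\int[P]_o (F v (path o) ^+ 2)%:E)%E) => [|w].
      by rewrite sumr_ge0// => v' _; exact: fine_ge0.
    have [wk|wk] := eqVneq (size w) k.
      rewrite (bigD1_seq w) ?uniq_words ?in_words ?wk//=.
      rewrite -[leLHS]fineK ?ge0_fin_numE ?Lfun2_sqr_lty// lee_fin lerDl.
      by rewrite sumr_ge0// => v' _; exact: fine_ge0.
    under eq_integral do rewrite F0// expr0n.
    by rewrite integral0 lee_fin sumr_ge0// => v' _; exact: fine_ge0.
  apply: (le_lt_trans _ (ltry r)).
  apply: integral_sqr_average => // u.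
  exact: (integral_sqr_block Q_pi X_bmc).
- exact: Lfun_cst.
apply: Lnorm2_cvg0 => eps eps0.
have [l0 l0P] := block_average_cvg Q_ergodic Q_pi X_bmc mF Fk F0 FL2 eps0.
have [n0 n0P] := enumeration_size v_enum l0.
exists n0 => n n0n; have := l0P (v n) (n0P n n0n).
apply: le_trans; rewrite le_eqVlt; apply/orP; left; apply/eqP.
by apply: eq_integral => o _; rewrite /= MbarE cE.
Qed.
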